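(* Let $a>0$, $x>0$, $0<\theta,\psi<1$, let $k\geq 2$ be an even integer, and let $\nu\in\mathbb{C}$ with $\Re(\nu)>0$. Then \begin{align*} &\left(\frac{a^2x}{4}\right)^{\frac{\nu}{2}+k+1}\sum_{n=1}^{\infty} n^{\nu/2}K_{\nu}(a\sqrt{nx})\sum_{d\mid n}d^k\cos(2\pi d\theta)\sin\left(\frac{2\pi n\psi}{d}\right)\\ &=\frac{(-1)^{k/2}(2\pi)^{k+1}}{8}\Gamma(\nu+k+1)\sum_{m,n\geq 0}\left\{\frac{(n+\psi)^k}{\left(\frac{16\pi^2}{a^2}\frac{(n+\psi)(m+\theta)}{x}+1\right)^{\nu+k+1}}-\frac{(n+1-\psi)^k}{\left(\frac{16\pi^2}{a^2}\frac{(n+1-\psi)(m+\theta)}{x}+1\right)^{\nu+k+1}}\right.\\ &\qquad\left.-\frac{(n+1-\psi)^k}{\left(\frac{16\pi^2}{a^2}\frac{(n+1-\psi)(m+1-\theta)}{x}+1\right)^{\nu+k+1}}+\frac{(n+\psi)^k}{\left(\frac{16\pi^2}{a^2}\frac{(n+\psi)(m+1-\theta)}{x}+1\right)^{\nu+k+1}}\right\}. \end{align*}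
   Context: $K_\nu$ denotes the modified Bessel function of the second kind of order $\nu$. The double sum runs over all pairs of non-negative integers $m,n$. *)

(* Defs.v *)
From Stdlib Require Import Reals.
From Coquelicot Require Import Coquelicot.
Open Scope R_scope.

Definition cexp (z : C) : C :=
  (exp (Re z) * cos (Im z), exp (Re z) * sin (Im z)).

Definition cpowR (b : R) (s : C) : C := cexp (Cmult s (RtoC (ln b))).

Definition ccosh (z : C) : C := Cdiv (Cplus (cexp z) (cexp (Copp z))) (RtoC 2).

Definition BesselK (nu : C) (z : R) : C :=
  RInt_gen (V := C_R_CompleteNormedModule)
    (fun t => Cmult (RtoC (exp (- z * cosh t))) (ccosh (Cmult nu (RtoC t))))
    (at_point 0) (Rbar_locally p_infty).

Definition CGamma (s : C) : C :=
  RInt_gen (V := C_R_CompleteNormedModule)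
    (fun t => Cmult (cpowR t (Cminus s (RtoC 1))) (RtoC (exp (- t))))
    (at_right 0) (Rbar_locally p_infty).

Definition divisor_sum (f : nat -> R) (n : nat) : R :=
  sum_n_m (fun d => if Nat.eqb (n mod d) 0 then f d else 0) 1 n.

(* Double series over all pairs (m,n) of non-negative integers, absolutely
   convergent, with value l (computed as an iterated sum). *)
Definition is_dsum (F : nat -> nat -> C) (l : C) : Prop :=
  (forall m, ex_series (fun n => Cmod (F m n))) /\
  ex_series (fun m => Series (fun n => Cmod (F m n))) /\
  exists G : nat -> C,
    (forall m, is_series (fun n => F m n) (G m)) /\ is_series G l.

(* Main.v *)
(* Write X = a^2 x / 4. In the logarithmic variable u, K_nu and Gamma have the
   integral representations
     2 (XN)^(nu/2) K_nu(a sqrt(Nx)) = int_R e^(nu u) exp(- e^u - X N e^(-u)) du,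
     Gamma(s) B^(-s) = int_R e^(s u) exp(- B e^u) du,
   so, after exchanging sum and integral, the theorem becomes the pointwise identity,
   for y = X e^(-u),
     4 y^(k+1) sum_N e^(-yN) sum_(d | N) d^k cos(2 pi d theta) sin(2 pi (N/d) psi)
       = (-1)^(k/2) (2 pi)^(k+1) sum_(m,n) (four terms +- U^k exp(- (4 pi^2 / y) U V)).
   Writing N = d r, the sum over d is a sum of inverse powers of y r + 2 pi i (m +- theta)
   by Lipschitz's formula
     sum_(n >= 0) (n + psi)^k e^(- (n + psi) z) = k! sum_(r in Z) e^(2 pi i r psi) / (z + 2 pi i r)^(k+1);
   exchanging the order of summation, Lipschitz's formula applied backwards evaluates the
   sum over r. Lipschitz's formula itself is the limit M -> oo, by dominated convergence,
   of the finite Fourier inversion formula on Z/M for the binomial series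
   (1 - x)^(-k-1) = sum_N (N + k choose k) x^N at the points x = exp (- (z + 2 pi i r) / M). *)

Require Import Defs.
From Corelib Require Import ssreflect.
From Stdlib Require Import Reals Lra Lia Factorial IndefiniteDescription FunctionalExtensionality.
From Coquelicot Require Import Coquelicot.
Open Scope R_scope.

Arguments INR : simpl never.

(** * Series *)

(* ring and field fail on an equality stated at the carrier of an algebraic structure. *)
Ltac eqR := match goal with |- @eq _ ?a ?b => change (@eq R a b) end.
Ltac eqC := match goal with |- @eq _ ?a ?b => change (@eq C a b) end.

(** Every exchange of limits is justified by a product majorant, and these majorants fix the
    exponents used below. On the dual side, U^k (1 + w U V)^(-s) decays only through the product U
    V. With sigma = Re nu, Re s = sigma + k + 1 and p = k + 1 + sigma/2, it is O(U^(-1-sigma/2)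
    V^(-p)): one half of sigma makes the sum over U converge, the other half leaves e^(sigma u/2),
    which makes the integral converge at -oo. In the sum over r and m, |y r + 2 pi i v|^2 >= y r v
    separates the variables, with exponent 3/2 for each as soon as k >= 2. The parity of k enters
    through 4 pi^2 v / y + 2 pi i r = (2 pi i / y) (y r - 2 pi i v): since k + 1 is odd, i^(k+1) =
    +- i exchanges real and imaginary parts, and so a cosine in theta can meet a sine in psi. The
    sums met on the way are not named by formulas; an identity between two series is therefore
    stated as the existence of a common sum. *)

Lemma sum_n_cvg_unif {K : AbsRing} {V : CompleteNormedModule K} {T : Type}
  (a : nat -> T -> V) (b : nat -> R) (s : T -> V) :
  ex_series b -> (forall m t, norm (a m t) <= b m) ->
  (forall t, is_series (fun m => a m t) (s t)) ->
  filterlim (fun M t => sum_n (fun m => a m t) M) eventually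
    (locally (s : fct_UniformSpace T V)).
Proof.
move=> /Cauchy_ex_series Hb Hab Hs P [eps HP].
have He : 0 < eps / 2 by have := cond_pos eps; lra.
have [N HN] := Hb (mkposreal _ He).
exists N => M HM; apply: HP => t.
have [N2 HN2] := Hs t _ (locally_ball (s t) (mkposreal _ He)).
(* This index depends on [t], but it drops out of the estimate: the tail from [M] to [K0] is
   controlled by [b] alone. *)
set K0 := S (Nat.max M N2).
have H1 := HN2 K0 ltac:(rewrite /K0; lia).
have -> : pos eps = eps / 2 + eps / 2 by field.
apply: ball_triangle H1 _.
apply: ball_sym; apply: norm_compat1.
have -> : minus (sum_n (fun m => a m t) K0) (sum_n (fun m => a m t) M)
  = sum_n_m (fun m => a m t) (S M) K0.
  by rewrite sum_n_m_sum_n //; rewrite /K0; lia.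
apply: Rle_lt_trans (norm_sum_n_m _ _ _) _.
apply: Rle_lt_trans (sum_n_m_le _ b _ _ _) _ => [k|]; first exact: Hab.
have := HN (S M) K0 ltac:(lia) ltac:(rewrite /K0; lia).
rewrite /=; apply: Rle_lt_trans; exact: Rle_abs.
Qed.

(** Tannery's theorem: the M-test makes the partial sums converge uniformly in [N], so the two
    limits can be exchanged. The existence of [L] belongs to the conclusion; hence a sequence [s]
    expanded in two ways yields two series with the same sum. *)
Lemma series_dominated {K : AbsRing} {V : CompleteNormedModule K}
  (a : nat -> nat -> V) (b : nat -> R) (l s : nat -> V) :
  ex_series b -> (forall m N, norm (a m N) <= b m) ->
  (forall m, filterlim (a m) eventually (locally (l m))) ->
  (forall N, is_series (fun m => a m N) (s N)) ->
  exists L, is_series l L /\ filterlim s eventually (locally L).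
Proof.
move=> Hb Hab Hl Hs.
apply: (filterlim_switch eventually _ eventually _
  (fun M N => sum_n (fun m => a m N) M) s (sum_n l)).
- exact: (sum_n_cvg_unif a b s Hb Hab Hs).
- elim=> [|M IH].
  + rewrite sum_O; apply: filterlim_ext (Hl 0%nat) => N; by rewrite sum_O.
  + rewrite sum_Sn.
    apply: (filterlim_ext (fun N => plus (sum_n (fun m => a m N) M) (a (S M) N))).
      by move=> N; rewrite sum_Sn.
    apply: filterlim_comp_2 IH (Hl _) (filterlim_plus _ _).
Qed.

Lemma is_series_unique_V {K : AbsRing} {V : NormedModule K} (a : nat -> V) (l1 l2 : V) :
  is_series a l1 -> is_series a l2 -> l1 = l2.
Proof.
move=> H1 H2; exact: (filterlim_locally_unique (sum_n a) l1 l2 H1 H2).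
Qed.

Lemma norm_series_le {K : AbsRing} {V : CompleteNormedModule K}
  (a : nat -> V) (b : nat -> R) (l : V) :
  (forall n, norm (a n) <= b n) -> ex_series b -> is_series a l -> norm l <= Series b.
Proof.
move=> Hab Hb Ha.
apply: (filterlim_le (F := eventually) (fun n => norm (sum_n a n)) (sum_n b)
  (norm l) (Series b)).
- exists 0%nat => n _.
  exact: Rle_trans (norm_sum_n_m _ _ _) (sum_n_m_le _ _ _ _ Hab).
- apply: filterlim_comp Ha _; exact: filterlim_norm.
- exact: Series_correct.
Qed.

(** Tannery's theorem for the inner sums truncated at [N], dominated by [A m * Series B]; summed
    over [m], they give the partial sums of [H]. *)
Lemma series_swap {K : AbsRing} {V : CompleteNormedModule K}
  (F : nat -> nat -> V) (A B : nat -> R) (G H : nat -> V) (L : V) :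
  ex_series A -> ex_series B ->
  (forall m, 0 <= A m) -> (forall n, 0 <= B n) ->
  (forall m n, norm (F m n) <= A m * B n) ->
  (forall m, is_series (F m) (G m)) -> (forall n, is_series (fun m => F m n) (H n)) ->
  is_series G L -> is_series H L.
Proof.
move=> HA HB A0 B0 HF HG HH HL.
have sumB N : sum_n B N <= Series B.
  apply: (is_lim_seq_incr_compare (sum_n B)); first exact: Series_correct.
  by move=> n; rewrite sum_Sn /plus /=; have := B0 (S n); lra.
have [L' [H1 H2]] : exists L', is_series G L' /\ filterlim (sum_n H) eventually (locally L').
  apply: (series_dominated (fun m N => sum_n (F m) N) (fun m => A m * Series B)).
  - exact: ex_series_scal_r.
  - move=> m N; apply: Rle_trans (norm_sum_n_m _ _ _) _.
    apply: Rle_trans (sum_n_m_le _ (fun n => A m * B n) _ _ _) _; first exact: HF.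
    rewrite -/(sum_n (fun n => A m * B n) N) (sum_n_mult_l (K := R_Ring) (A m) B N).
    exact: Rmult_le_compat_l.
  - exact: HG.
  - elim=> [|N IH].
    + rewrite sum_O; apply: is_series_ext (HH 0%nat) => m; by rewrite sum_O.
    + rewrite sum_Sn; apply: is_series_ext (is_series_plus _ _ _ _ IH (HH (S N))).
      by move=> m; rewrite sum_Sn.
by rewrite (is_series_unique_V _ _ _ HL H1).
Qed.

Lemma ex_series_telescope (u : nat -> R) :
  (forall n, u (S n) <= u n) -> (forall n, 0 <= u n) ->
  ex_series (fun n => u n - u (S n)).
Proof.
move=> Hdec Hpos.
have [l Hl] := ex_finite_lim_seq_decr u 0 Hdec Hpos.
exists (u 0%nat - l).
change (is_lim_seq (sum_n (fun n => u n - u (S n))) (Finite (u 0%nat - l))).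
apply: (is_lim_seq_ext (fun n => u 0%nat - u (S n))).
  elim=> [|n IH]; first by rewrite sum_O.
  by rewrite sum_Sn -IH /plus /=; ring.
apply: is_lim_seq_minus'; first exact: is_lim_seq_const.
by apply/(is_lim_seq_incr_1 u).
Qed.

(** * Power-law majorants *)

Lemma Rpower_pos (x p : R) : 0 < Rpower x p.
Proof. exact: exp_pos. Qed.

(** Discrete integral test: with q = p - 1, two uses of e^t >= 1 + t give q (n + 2)^(-p) <= (n +
    1)^(-q) - (n + 2)^(-q), and the right side telescopes. *)
Lemma ex_series_Rpower (p : R) : 1 < p -> ex_series (fun n => Rpower (INR n + 1) (- p)).
Proof.
move=> Hp; set q := p - 1; have Hq : 0 < q by rewrite /q; lra.
set u := fun n => Rpower (INR n + 1) (- q).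
have Hstep n : q * Rpower (INR (S n) + 1) (- p) <= u n - u (S n).
  have Hn := pos_INR n; rewrite S_INR; set x := INR n + 1.
  have Hx : 1 <= x by rewrite /x; lra.
  have -> : u (S n) = Rpower (x + 1) (- q) by rewrite /u S_INR.
  have -> : u n = Rpower (x + 1) (- q) * exp (- (q * ln (x / (x + 1)))).
    rewrite /u -/x /Rpower -exp_plus; congr exp.
    rewrite ln_div; try lra.
  have -> : Rpower (x + 1) (- p) = Rpower (x + 1) (- q) * / (x + 1).
    rewrite -{3}(Rpower_1 (x + 1)); last lra.
    rewrite -Rpower_Ropp -Rpower_plus; congr Rpower; rewrite /q; ring.
  have H1 := exp_ineq1_le (- (q * ln (x / (x + 1)))).
  have H2 := exp_ineq1_le (ln (x / (x + 1))).
  rewrite exp_ln in H2; last by apply: Rdiv_lt_0_compat; lra.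
  have E : x / (x + 1) = 1 - / (x + 1) by field; lra.
  have H3 : q * ln (x / (x + 1)) <= q * (- / (x+1)).
    apply: Rmult_le_compat_l; lra.
  have H4 := Rpower_pos (x + 1) (- q).
  have -> : q * (Rpower (x + 1) (- q) * / (x + 1)) = Rpower (x + 1) (- q) * (q * / (x + 1)) by ring.
  have -> : forall e, Rpower (x + 1) (- q) * e - Rpower (x + 1) (- q) = Rpower (x + 1) (- q) * (e - 1) by move=> e; ring.
  apply: Rmult_le_compat_l; lra.
have Hdec n : u (S n) <= u n.
  have := Hstep n; have := Rpower_pos (INR (S n) + 1) (- p); nra.
apply/ex_series_incr_1.
apply: (ex_series_ext (fun n => / q * (q * Rpower (INR (S n) + 1) (- p)))).
  by move=> n; eqR; field; lra.
apply: ex_series_scal_l.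
apply: (ex_series_le _ (fun n => u n - u (S n))).
  move=> n; apply: Rle_trans (Hstep n).
  change (Rabs (q * Rpower (INR (S n) + 1) (- p)) <= q * Rpower (INR (S n) + 1) (- p)).
  rewrite Rabs_pos_eq; first exact: Rle_refl.
  apply: Rmult_le_pos; [lra | exact: Rlt_le (Rpower_pos _ _)].
apply: ex_series_telescope => // n; exact: Rlt_le (Rpower_pos _ _).
Qed.

(** The maximum of x^p e^(-x), at x = p, is p^p e^(-p); the factor e^(-p) is given away. All the
    decay estimates for exponentials against powers come from here. *)
Lemma exp_neg_le_Rpower (p x : R) : 0 < p -> 0 < x ->
  exp (- x) <= Rpower p p * Rpower x (- p).
Proof.
move=> Hp Hx; rewrite /Rpower -exp_plus.
have H := exp_ineq1_le (ln (x / p)).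
rewrite exp_ln in H; last exact: Rdiv_lt_0_compat.
rewrite ln_div // in H.
have : p * (1 + (ln x - ln p)) <= p * (x / p) by apply: Rmult_le_compat_l; lra.
have -> : p * (x / p) = x by field; lra.
move=> H2.
case: (Req_dec (- x) (p * ln p + - p * ln x)) => [->|Hne]; first lra.
apply: Rlt_le; apply: exp_increasing; lra.
Qed.

Lemma Rpower_neg_le (x y p : R) : 0 <= p -> 0 < x <= y -> Rpower y (- p) <= Rpower x (- p).
Proof.
move=> Hp Hxy; rewrite !Rpower_Ropp; apply: Rinv_le_contravar; first exact: Rpower_pos.
exact: Rle_Rpower_l.
Qed.

(** * Complex exponential and limits *)

Lemma cexp_plus (z w : C) : cexp (z + w) = (cexp z * cexp w)%C.
Proof.
rewrite /cexp; case: z => a b; case: w => c d.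
rewrite /Re /Im /= exp_plus cos_plus sin_plus /Cmult /=; congr pair; ring.
Qed.

Lemma cexp_0 : cexp 0 = 1.
Proof.
by rewrite /cexp /Re /Im /= exp_0 cos_0 sin_0 Rmult_1_l Rmult_0_r.
Qed.

Lemma Cmod_cexp (z : C) : Cmod (cexp z) = exp (Re z).
Proof.
rewrite /Cmod /cexp /=; set e := exp (Re z).
have He : 0 < e by exact: exp_pos.
have H := sin2_cos2 (Im z); rewrite /Rsqr in H.
have -> : e * cos (Im z) * (e * cos (Im z) * 1) + e * sin (Im z) * (e * sin (Im z) * 1)
  = e * e * (sin (Im z) * sin (Im z) + cos (Im z) * cos (Im z)) by ring.
rewrite H Rmult_1_r; apply: sqrt_square; lra.
Qed.

Lemma cexp_neq_0 (z : C) : cexp z <> 0.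
Proof. by apply/Cmod_gt_0; rewrite Cmod_cexp; exact: exp_pos. Qed.

Lemma cexp_pow (z : C) (n : nat) : (cexp z ^ n)%C = cexp (INR n * z).
Proof.
elim: n => [|n IH]; first by rewrite /= Cmult_0_l cexp_0.
rewrite Cpow_S IH -cexp_plus S_INR RtoC_plus; congr cexp; ring.
Qed.

Lemma cexp_opp (z : C) : cexp (- z) = (/ cexp z)%C.
Proof.
have H : (cexp (- z) * cexp z)%C = 1.
  rewrite -cexp_plus -cexp_0; congr cexp; ring.
have Hz := cexp_neq_0 z.
by rewrite -(Cmult_1_l (/ cexp z)) -H -Cmult_assoc Cinv_r // Cmult_1_r.
Qed.

Lemma cexp_2PI_nat (n : nat) : cexp (0, 2 * PI * INR n) = 1.
Proof.
rewrite /cexp /Re /Im /= exp_0.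
have -> : 2 * PI * INR n = 0 + 2 * INR n * PI by ring.
by rewrite cos_period sin_period cos_0 sin_0 Rmult_1_l Rmult_0_r.
Qed.

Lemma filterlim_C_pair {T} (F : (T -> Prop) -> Prop) {FF : Filter F} (u v : T -> R) (a b : R) :
  filterlim u F (locally a) -> filterlim v F (locally b) ->
  filterlim (fun n => (u n, v n) : C) F (locally ((a, b) : C)).
Proof.
move=> Hu Hv; apply/filterlim_locally => eps.
have /filterlim_locally/(_ eps) H1 := Hu.
have /filterlim_locally/(_ eps) H2 := Hv.
apply: filter_imp (filter_and _ _ H1 H2) => t [A B]; by split.
Qed.

Lemma filterlim_Re {T} (F : (T -> Prop) -> Prop) {FF : Filter F} (u : T -> C) (l : C) :
  filterlim u F (locally l) -> filterlim (fun n => Re (u n)) F (locally (Re l)).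
Proof.
move=> Hu; apply/filterlim_locally => eps.
have /filterlim_locally/(_ eps) H1 := Hu.
by apply: filter_imp H1 => t [A B].
Qed.

Lemma filterlim_Im {T} (F : (T -> Prop) -> Prop) {FF : Filter F} (u : T -> C) (l : C) :
  filterlim u F (locally l) -> filterlim (fun n => Im (u n)) F (locally (Im l)).
Proof.
move=> Hu; apply/filterlim_locally => eps.
have /filterlim_locally/(_ eps) H1 := Hu.
by apply: filter_imp H1 => t [A B].
Qed.

Definition clim (u : nat -> C) (l : C) := filterlim u eventually (locally l).

Lemma clim_pair (u v : nat -> R) (a b : R) :
  is_lim_seq u a -> is_lim_seq v b -> clim (fun n => (u n, v n)) (a, b).
Proof. move=> Hu Hv; exact: filterlim_C_pair. Qed.

Lemma clim_Re (u : nat -> C) (l : C) : clim u l -> is_lim_seq (fun n => Re (u n)) (Re l).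
Proof. move=> H; exact: (filterlim_Re eventually u l H). Qed.

Lemma clim_Im (u : nat -> C) (l : C) : clim u l -> is_lim_seq (fun n => Im (u n)) (Im l).
Proof. move=> H; exact: (filterlim_Im eventually u l H). Qed.

Lemma clim_ext (u v : nat -> C) (l : C) : (forall n, u n = v n) -> clim u l -> clim v l.
Proof. move=> H; exact: filterlim_ext. Qed.

Lemma clim_const (c : C) : clim (fun _ => c) c.
Proof. exact: filterlim_const. Qed.

Lemma clim_RtoC (u : nat -> R) (l : R) : is_lim_seq u l -> clim (fun n => RtoC (u n)) l.
Proof. move=> H; apply: clim_pair => //; exact: is_lim_seq_const. Qed.

Lemma clim_plus (u v : nat -> C) (a b : C) :
  clim u a -> clim v b -> clim (fun n => u n + v n)%C (a + b)%C.
Proof.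
move=> Hu Hv; apply: clim_pair; apply: is_lim_seq_plus'.
- exact: (clim_Re _ _ Hu).
- exact: (clim_Re _ _ Hv).
- exact: (clim_Im _ _ Hu).
- exact: (clim_Im _ _ Hv).
Qed.

Lemma clim_mult (u v : nat -> C) (a b : C) :
  clim u a -> clim v b -> clim (fun n => u n * v n)%C (a * b)%C.
Proof.
move=> Hu Hv.
have H1 := clim_Re _ _ Hu; have H2 := clim_Re _ _ Hv.
have H3 := clim_Im _ _ Hu; have H4 := clim_Im _ _ Hv.
apply: clim_pair.
- apply: is_lim_seq_minus'; exact: is_lim_seq_mult'.
- apply: is_lim_seq_plus'; exact: is_lim_seq_mult'.
Qed.

Lemma clim_inv (u : nat -> C) (a : C) : a <> 0 -> clim u a -> clim (fun n => / u n)%C (/ a)%C.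
Proof.
move=> Ha Hu.
have H1 := clim_Re _ _ Hu; have H3 := clim_Im _ _ Hu.
have Hne : fst a ^ 2 + snd a ^ 2 <> 0.
  move=> H; apply: Ha; case: a {Hu H1 H3} H => p q /= H.
  have E1 : p = 0 by nra. 
  have E2 : q = 0 by nra.
  by rewrite E1 E2.
have HD : is_lim_seq (fun n => / (fst (u n) ^ 2 + snd (u n) ^ 2)) (/ (fst a ^ 2 + snd a ^ 2)).
  apply: (is_lim_seq_inv _ (fst a ^ 2 + snd a ^ 2)); last by move=> [].
  rewrite /=; apply: is_lim_seq_plus'; apply: is_lim_seq_mult' => //;
    apply: is_lim_seq_mult' => //; exact: is_lim_seq_const.
apply: clim_pair.
- exact: is_lim_seq_mult'.
- apply: is_lim_seq_mult' => //; exact: (proj1 (is_lim_seq_opp _ (Finite (Im a)))).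
Qed.

Lemma clim_pow (u : nat -> C) (a : C) (k : nat) :
  clim u a -> clim (fun n => u n ^ k)%C (a ^ k)%C.
Proof.
move=> Hu; elim: k => [|k IH]; first exact: clim_const.
exact: clim_mult.
Qed.

Lemma clim_cexp (u : nat -> C) (a : C) : clim u a -> clim (fun n => cexp (u n)) (cexp a).
Proof.
move=> Hu; have H1 := clim_Re _ _ Hu; have H3 := clim_Im _ _ Hu.
apply: clim_pair; apply: is_lim_seq_mult'.
- apply: (is_lim_seq_continuous exp) H1; exact: derivable_continuous_pt (derivable_pt_exp _).
- apply: (is_lim_seq_continuous cos) H3; exact: continuity_cos.
- apply: (is_lim_seq_continuous exp) H1; exact: derivable_continuous_pt (derivable_pt_exp _).
- apply: (is_lim_seq_continuous sin) H3; exact: continuity_sin.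
Qed.

Lemma clim_unique (u : nat -> C) (a b : C) : clim u a -> clim u b -> a = b.
Proof.
move=> H1 H2.
exact: (filterlim_locally_unique (V := C_NormedModule) (F := eventually) u a b H1 H2).
Qed.

Lemma clim_0_Cmod (u : nat -> C) : is_lim_seq (fun n => Cmod (u n)) 0 -> clim u 0.
Proof.
move=> H.
have Hr : is_lim_seq (fun n => Re (u n)) 0.
  apply/is_lim_seq_abs_0; apply: (is_lim_seq_le_le (fun _ => 0)) H; last exact: is_lim_seq_const.
  move=> n; split; [exact: Rabs_pos | exact: re_le_Cmod].
have Hi : is_lim_seq (fun n => Im (u n)) 0.
  apply/is_lim_seq_abs_0; apply: (is_lim_seq_le_le (fun _ => 0)) H; last exact: is_lim_seq_const.
  move=> n; split; [exact: Rabs_pos |].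
  apply: Rle_trans (Rmax_r _ _) (Rmax_Cmod _).
apply: clim_ext (clim_pair _ _ _ _ Hr Hi) => n; by rewrite -surjective_pairing.
Qed.

Lemma is_series_sum_n {K : AbsRing} {V : NormedModule K} (F : nat -> nat -> V) (G : nat -> V) (P : nat) :
  (forall m, is_series (F m) (G m)) ->
  is_series (fun n => sum_n (fun m => F m n) P) (sum_n G P).
Proof.
move=> H; elim: P => [|P IH].
  rewrite sum_O; apply: is_series_ext (H 0%nat) => m; by rewrite sum_O.
rewrite sum_Sn; apply: is_series_ext (is_series_plus _ _ _ _ IH (H (S P))).
by move=> m; rewrite sum_Sn.
Qed.

(** The partial sums of the grouped series are those of [a] at the indices P (M + 1) + M. With the
    modulus as block length, grouping separates the residue classes. *)
Lemma is_series_blocks {K : AbsRing} {V : NormedModule K} (a : nat -> V) (l : V) (M : nat) :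
  is_series a l -> is_series (fun n => sum_n (fun i => a (n * S M + i)%nat) M) l.
Proof.
move=> H.
apply: (filterlim_ext (fun P => sum_n a (P * S M + M)%nat)).
  elim=> [|P IH].
    by rewrite sum_O.
  rewrite sum_Sn -IH /sum_n.
  rewrite (sum_n_m_Chasles a 0 (P * S M + M)); try lia.
  congr plus.
  have -> : S (P * S M + M) = (0 + S P * S M)%nat by lia.
  have -> : (S P * S M + M = M + S P * S M)%nat by lia.
  move: (S P * S M)%nat => q.
  elim: q a {H IH} => [|q IHq] a.
    rewrite !Nat.add_0_r; exact: sum_n_m_ext.
  rewrite !Nat.add_succ_r -sum_n_m_S IHq.
  by apply: sum_n_m_ext => i; rewrite Nat.add_succ_l.
apply: filterlim_comp H => Q [N HN]; exists N => n Hn; apply: HN; nia.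
Qed.

Lemma is_series_finite {K : AbsRing} {V : NormedModule K} (a : nat -> V) (M : nat) :
  (forall n, (M < n)%nat -> a n = zero) -> is_series a (sum_n a M).
Proof.
move=> H; apply: (filterlim_ext_loc (fun _ => sum_n a M)); last exact: filterlim_const.
exists M => n; elim=> [//|m Hm IH].
rewrite sum_Sn -IH H ?plus_zero_r //; lia.
Qed.

(** * Lipschitz formula *)

(* The binomial coefficient (N + k choose k), as a polynomial in N. *)
Fixpoint rising_binom (k : nat) (x : R) : R :=
  match k with
  | O => 1
  | S k' => rising_binom k' x * (x + INR k) / INR k
  end.
Arguments rising_binom : simpl never.

Lemma rising_binomS (k : nat) (x : R) :
  rising_binom (S k) x = rising_binom k x * (x + INR (S k)) / INR (S k).
Proof. by []. Qed.

(** The ratio of consecutive coefficients, which yields both Pascal's rule and the limit in the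
    ratio test. *)
Lemma rising_binom_shift (k : nat) (x : R) :
  rising_binom k (x + 1) * (x + 1) = rising_binom k x * (x + INR k + 1).
Proof.
elim: k => [|k IH]; first by rewrite /rising_binom /INR; ring.
rewrite !rising_binomS.
have Hk := pos_INR k.
have -> : rising_binom k (x + 1) * (x + 1 + INR (S k)) / INR (S k) * (x + 1)
  = (rising_binom k (x + 1) * (x + 1)) * (x + 1 + INR (S k)) / INR (S k).
  by rewrite S_INR; field; lra.
rewrite IH S_INR; field; lra.
Qed.

Lemma rising_binom_pascal (k : nat) (x : R) :
  rising_binom (S k) (x + 1) = rising_binom (S k) x + rising_binom k (x + 1).
Proof.
have H := rising_binom_shift k x; rewrite !rising_binomS.
have Hk := pos_INR k; rewrite S_INR.
have -> : rising_binom k x * (x + (INR k + 1)) = rising_binom k (x + 1) * (x + 1).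
  rewrite H; ring.
field; lra.
Qed.

Lemma rising_binom_0 (k : nat) : rising_binom k 0 = 1.
Proof.
elim: k => [//|k IH]; rewrite rising_binomS IH S_INR; have Hk := pos_INR k; field; lra.
Qed.

Lemma rising_binom_pos (k : nat) (x : R) : 0 <= x -> 0 < rising_binom k x.
Proof.
move=> Hx; elim: k => [|k IH]; first by rewrite /rising_binom /=; lra.
rewrite rising_binomS; have Hk := pos_INR k; rewrite S_INR.
apply: Rdiv_lt_0_compat; last lra.
apply: Rmult_lt_0_compat => //; lra.
Qed.

Lemma rising_binom_le (k : nat) (x : R) : 0 <= x -> rising_binom k x <= (x + INR k) ^ k.
Proof.
move=> Hx; elim: k => [|k IH]; first by rewrite /rising_binom /=; lra.
rewrite rising_binomS; have Hk := pos_INR k; rewrite S_INR.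
have Hp := rising_binom_pos k x Hx.
apply: (Rle_trans _ (rising_binom k x * (x + (INR k + 1)))).
  rewrite /Rdiv -[X in _ <= X]Rmult_1_r; apply: Rmult_le_compat_l.
    apply: Rmult_le_pos; lra.
  rewrite -Rinv_1; apply: Rinv_le_contravar; lra.
rewrite /= Rmult_comm; apply: Rmult_le_compat_l; first lra.
apply: Rle_trans IH _; apply: pow_incr; lra.
Qed.

Lemma ex_series_rising_binom (k : nat) (q : R) : 0 < q < 1 ->
  ex_series (fun N => rising_binom k (INR N) * q ^ N).
Proof.
move=> Hq.
have Hpos N : 0 < rising_binom k (INR N) * q ^ N.
  apply: Rmult_lt_0_compat; first exact: rising_binom_pos (pos_INR _).
  apply: pow_lt; lra.
apply: (ex_series_ext (fun N => Rabs (rising_binom k (INR N) * q ^ N))).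
  move=> N; apply: Rabs_pos_eq; exact: Rlt_le.
apply: (ex_series_DAlembert _ q); first lra.
  move=> N; apply: Rgt_not_eq; exact: Hpos.
apply: (is_lim_seq_ext (fun N => (1 + INR k * / (INR N + 1)) * q)).
  move=> N; have HN := pos_INR N.
  have Hb := rising_binom_pos k (INR N) HN.
  have Hqn : q ^ N <> 0 by apply: pow_nonzero; lra.
  have E : rising_binom k (INR (S N)) = rising_binom k (INR N) * (INR N + INR k + 1) / (INR N + 1).
    rewrite S_INR -rising_binom_shift; field; lra.
  rewrite E Rabs_pos_eq.
    rewrite /=; field; split; lra.
  apply: Rlt_le; apply: Rdiv_lt_0_compat; last exact: Hpos.
  rewrite -E; apply: Rmult_lt_0_compat; first exact: rising_binom_pos (pos_INR _).
  apply: pow_lt; lra.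
have H : is_lim_seq (fun N => (1 + INR k * / (INR N + 1)) * q) ((1 + INR k * 0) * q).
  apply: is_lim_seq_mult'; last exact: is_lim_seq_const.
  apply: is_lim_seq_plus'; first exact: is_lim_seq_const.
  apply: is_lim_seq_mult'; first exact: is_lim_seq_const.
  apply: (is_lim_seq_ext (fun N => / INR (S N))).
    by move=> N; rewrite S_INR.
  have := is_lim_seq_inv INR p_infty is_lim_seq_INR ltac:(by []).
  by move/is_lim_seq_incr_1.
by rewrite Rmult_0_r Rplus_0_r Rmult_1_l in H.
Qed.

Lemma Cmod_RtoC_pos (x : R) : 0 <= x -> Cmod x = x.
Proof. by move=> H; rewrite Cmod_R Rabs_pos_eq. Qed.

(** Induction on [k]: multiplication by 1 - z lowers the order by one, up to a boundary term that
    tends to 0. The condition [z <> 0] serves the ratio test, which divides by the terms. *)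
Lemma is_series_rising_binom (k : nat) (z : C) : z <> 0 -> Cmod z < 1 ->
  is_series (V := C_NormedModule) (fun N => (RtoC (rising_binom k (INR N)) * z ^ N)%C)
    (/ (1 - z) ^ S k)%C.
Proof.
move=> Hz0 Hz.
have Hq : 0 < Cmod z < 1 by split => //; apply/Cmod_gt_0.
have Hz1 : (1 - z)%C <> 0.
  move=> H; have E : z = 1 by rewrite -(Cplus_0_r z) -H; ring.
  by rewrite E Cmod_1 in Hz; lra.
have tail j (c : R) : clim (fun N => RtoC c * (RtoC (rising_binom j (INR N)) * z ^ N))%C 0.
  rewrite -(Cmult_0_r c); apply: clim_mult; first exact: clim_const.
  apply: clim_0_Cmod.
  apply: (is_lim_seq_ext (fun N => rising_binom j (INR N) * Cmod z ^ N)).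
    move=> N; rewrite Cmod_mult Cmod_pow Cmod_RtoC_pos //.
    exact: Rlt_le (rising_binom_pos _ _ (pos_INR _)).
  exact: ex_series_lim_0 (ex_series_rising_binom _ _ Hq).
(* (1 - z) times the partial sum telescopes, by Pascal's rule *)
have step (j : nat) (S0 : nat -> C) l :
    (forall N, (1 - z) * sum_n (fun N => RtoC (rising_binom j (INR N)) * z ^ N)%C N
       = S0 N - z * (RtoC (rising_binom j (INR N)) * z ^ N))%C ->
    clim S0 l ->
    is_series (V := C_NormedModule) (fun N => (RtoC (rising_binom j (INR N)) * z ^ N)%C) (/ (1 - z) * l)%C.
  move=> HS Hl.
  apply: (clim_ext (fun N => / (1 - z) * (S0 N + (- z) * (RtoC (rising_binom j (INR N)) * z ^ N)))%C).
    move=> N; have E := HS N.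
    have -> : (S0 N + - z * (RtoC (rising_binom j (INR N)) * z ^ N)
      = (1 - z) * sum_n (fun N => RtoC (rising_binom j (INR N)) * z ^ N)%C N)%C.
      rewrite E; ring.
    rewrite Cmult_assoc Cinv_l //; exact: Cmult_1_l.
  have -> : (/ (1 - z) * l = / (1 - z) * (l + (-z) * 0))%C by ring.
  apply: clim_mult; first exact: clim_const.
  apply: clim_plus => //; apply: clim_mult; first exact: clim_const.
  apply: clim_ext (tail j 1) => N; ring.
elim: k => [|k IH].
  rewrite Cpow_1_r -(Cmult_1_r (/ (1 - z))).
  apply: (step 0%nat (fun _ => RtoC 1)); last exact: clim_const.
  elim=> [|N IHN]; first by rewrite sum_O /rising_binom /=; ring.
  rewrite sum_Sn /plus /= Cmult_plus_distr_l.
  rewrite IHN /rising_binom; ring.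
have -> : (/ (1 - z) ^ S (S k) = / (1 - z) * / (1 - z) ^ S k)%C.
  rewrite (Cpow_S _ (S k)); field; split => //; exact: Cpow_nz.
apply: (step (S k) _ _ _ IH).
elim=> [|N IHN].
  rewrite !sum_O !rising_binom_0 /=; ring.
rewrite !sum_Sn /plus /= Cmult_plus_distr_l.
rewrite IHN.
rewrite [INR (S N)]S_INR rising_binom_pascal RtoC_plus.
rewrite /=; ring.
Qed.

Arguments Cpow : simpl never.

Lemma Csum_scal (c : C) (a : nat -> C) (n : nat) :
  sum_n (fun i => c * a i)%C n = (c * sum_n a n)%C.
Proof. exact: (sum_n_mult_l (K := C_Ring) c a n). Qed.

Lemma Csum_plus (a b : nat -> C) (n : nat) :
  sum_n (fun i => a i + b i)%C n = (sum_n a n + sum_n b n)%C.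
Proof. exact: (sum_n_plus (G := C_AbelianMonoid) a b n). Qed.

Lemma Csum_S (a : nat -> C) (n : nat) : sum_n a (S n) = (sum_n a n + a (S n))%C.
Proof. exact: (sum_Sn (G := C_AbelianMonoid) a n). Qed.

Lemma Csum_single (a : C) (j n : nat) : (j <= n)%nat ->
  sum_n (fun i => if Nat.eqb i j then a else 0 : C) n = a.
Proof.
elim: n => [|n IH] Hj.
  by rewrite sum_O; have -> : j = 0%nat by lia.
rewrite Csum_S; case: (Nat.eqb_spec (S n) j) => Hn.
  have -> : sum_n (fun i => if Nat.eqb i j then a else 0 : C) n = RtoC 0.
    have : (n < j)%nat by lia.
    elim: n {IH Hj Hn} => [|n IH] Hn.
      by rewrite sum_O; case: (Nat.eqb_spec 0 j) => // ?; lia.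
    rewrite Csum_S IH; last lia.
    case: (Nat.eqb_spec (S n) j) => ?; first lia.
    exact: Cplus_0_l.
  exact: Cplus_0_l.
rewrite IH; last lia.
exact: Cplus_0_r.
Qed.

(** * Finite Fourier inversion *)

Definition cis (t : R) : C := cexp (0, t).

Lemma cis_opp (t : R) : cis (- t) = (/ cis t)%C.
Proof. rewrite /cis -cexp_opp; congr cexp; by rewrite /Copp /= Ropp_0. Qed.

Lemma cis_nat (n : nat) : cis (2 * PI * INR n) = 1.
Proof. exact: cexp_2PI_nat. Qed.

Lemma INR_2 : INR 2 = 2.
Proof. by rewrite /INR; ring. Qed.

Lemma sin_PI_diff (i j : nat) : sin (PI * (INR i - INR j)) = 0.
Proof.
apply: sin_eq_0_1; exists (Z.of_nat i - Z.of_nat j)%Z.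
by rewrite minus_IZR -!INR_IZR_INZ; ring.
Qed.

Lemma cis_plus (s t : R) : cis (s + t) = (cis s * cis t)%C.
Proof. rewrite /cis -cexp_plus; congr cexp; by rewrite /Cplus /= Rplus_0_l. Qed.

Lemma cis_0 : cis 0 = 1.
Proof. exact: cexp_0. Qed.

(* Orthogonality of the characters of Z/(2L), with the residues represented by
   the integers -m and m + 1 for 0 <= m < L; here L = P + 1. *)
Lemma character_sum (P i j : nat) : (i < 2 * S P)%nat -> (j < 2 * S P)%nat ->
  let t := 2 * PI * (INR i - INR j) / INR (2 * S P) in
  sum_n (fun m => cis (INR m * t) + cis (- (INR m + 1) * t))%C P
  = if Nat.eqb i j then RtoC (INR (2 * S P)) else RtoC 0.
Proof.
move=> Hi Hj t.
have HM : 0 < INR (2 * S P) by apply: lt_0_INR; lia.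
case: (Nat.eqb_spec i j) => Hij.
  have Ht : t = 0 by rewrite /t Hij Rminus_diag /Rdiv Rmult_0_r Rmult_0_l.
  rewrite Ht.
  elim: P {Hi Hj t HM Ht} => [|P IH].
    rewrite sum_O !Rmult_0_r cis_0 -RtoC_plus; congr RtoC; rewrite /INR /=; ring.
  rewrite Csum_S IH !Rmult_0_r cis_0 -!RtoC_plus; congr RtoC.
  have -> : (2 * S (S P) = S (S (2 * S P)))%nat by lia.
  move: (2 * S P)%nat => q; rewrite !S_INR; ring.
(* Multiplication by cis t - 1 telescopes in both directions at once and leaves the two symmetric
   end terms. *)
have tele Q : ((cis (t) - 1) * sum_n (fun m => cis (INR m * t) + cis (- (INR m + 1) * t)) Q
   = cis ((INR Q + 1) * t) - cis (- (INR Q + 1) * t))%C.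
  elim: Q => [|Q IH].
    rewrite sum_O.
    have -> : (INR 0 * t) = 0 by rewrite /INR; ring.
    have -> : (INR 0 + 1) * t = t by rewrite /INR; ring.
    have -> : - (INR 0 + 1) * t = - t by rewrite /INR; ring.
    have H : (cis (t) * cis (- t) = 1)%C.
      by rewrite -cis_plus Rplus_opp_r cis_0.
    rewrite cis_0.
    have -> : ((cis (t) - 1) * (1 + cis (- t)) = cis (t) * cis (- t) + cis (t) - cis (-t) - 1)%C by ring.
    rewrite H; ring.
  rewrite Csum_S Cmult_plus_distr_l IH S_INR.
  have -> : (INR Q + 1 + 1) * t = (INR Q + 1) * t + t by ring.
  have -> : - (INR Q + 1) * t = - (INR Q + 1 + 1) * t + t by ring.
  rewrite !cis_plus; ring.
(* If cis t = 1, then sin (t/2) = 0, so 2 L divides i - j, which is impossible for 0 < |i - j| < 2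
   L. *)
have Hz : (cis (t) - 1)%C <> 0.
  rewrite /cis /cexp /Re /Im /= exp_0 !Rmult_1_l => -[Hc Hs].
  have Ht : t = 2 * (t / 2) by field.
  have Hcos : cos t = 1 by lra.
  have Hsin : sin (t / 2) = 0.
    rewrite Ht cos_2a_sin in Hcos; nra.
  have [q Hq] := sin_eq_0_0 _ Hsin.
  have E : INR i - INR j = IZR q * INR (2 * S P).
    have HPI := PI_RGT_0.
    apply: (Rmult_eq_reg_l PI); last lra.
    have -> : PI * (IZR q * INR (2 * S P)) = (IZR q * PI) * INR (2 * S P) by ring.
    rewrite -Hq /t; field; lra.
  rewrite !INR_IZR_INZ -minus_IZR -mult_IZR in E.
  have E2 := eq_IZR _ _ E.
  have : q = 0%Z by nia.
  move=> Hq0; rewrite Hq0 in E2; lia.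
have E := tele P.
(* Here (P + 1) t = pi (i - j), so the end terms differ by 2 i sin (pi (i - j)) = 0. This rests on
   the modulus being exactly twice P + 1. *)
have E0 : (cis ((INR P + 1) * t) - cis (- (INR P + 1) * t) = 0)%C.
  have -> : (INR P + 1) * t = PI * (INR i - INR j).
    have HP := pos_INR P.
    rewrite /t mult_INR (S_INR P) INR_2; field; lra.
  have -> : - (INR P + 1) * t = - (PI * (INR i - INR j)).
    have HP := pos_INR P.
    rewrite /t mult_INR (S_INR P) INR_2; field; lra.
  rewrite /cis /cexp /Re /Im /= sin_neg cos_neg sin_PI_diff /Cminus /Cplus /Copp /=.
  congr pair; ring.
rewrite E0 in E.
have -> : sum_n (fun m => cis (INR m * t) + cis (- (INR m + 1) * t))%C P
  = (/ (cis (t) - 1) * ((cis (t) - 1) * sum_n (fun m => cis (INR m * t) + cis (- (INR m + 1) * t)) P))%C.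
  rewrite Cmult_assoc Cinv_l // Cmult_1_l //.
rewrite E Cmult_0_r //.
Qed.

(* exp (- w / M) for w = a + 2 pi i v *)
Definition dft_node (M : nat) (a v : R) : C := cexp (- (a / INR M), - (2 * PI * v / INR M)).

(** Discrete counterpart of e^(2 pi i r psi) / (a + 2 pi i (r - theta))^(k+1), with j / M in place
    of psi; the two match after division by M^(k+1), as M grows. *)
Definition dft_term (k M j : nat) (a theta r : R) : C :=
  (cis (2 * PI * r * (INR j / INR M)) * / (1 - dft_node M a (r - theta)) ^ S k)%C.

(** Discrete counterpart of u^k / k! e^(- (a - 2 pi i theta) u) at u = N / M; here the scaling
    factor is M^k. *)
Definition dft_val (k M : nat) (a theta : R) (N : nat) : C :=
  (RtoC (rising_binom k (INR N)) * cexp ((- (a * (INR N / INR M)))%R, (2 * PI * theta * (INR N / INR M))%R))%C.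

Lemma dft_node_Cmod (M : nat) (a v : R) : 0 < a -> (0 < M)%nat -> Cmod (dft_node M a v) < 1.
Proof.
move=> Ha /lt_0_INR HM.
rewrite Cmod_cexp /= -exp_0; apply: exp_increasing.
have := Rdiv_lt_0_compat _ _ Ha HM; lra.
Qed.

(** The binomial series at the node, grouped by residues modulo 2 (P + 1), whose largest residue is
    2 P + 1. The disjunction with [q] expresses that [r] is an integer. *)
Lemma dft_term_series (k P j : nat) (a theta r : R) (q : nat) :
  0 < a -> (r = - INR q \/ r = INR q) ->
  is_series (V := C_NormedModule)
    (fun n => sum_n (fun i => dft_val k (2 * S P) a theta (n * (2 * S P) + i)
       * cis (- r * (2 * PI * (INR i - INR j) / INR (2 * S P))))%C (2 * P + 1))
    (dft_term k (2 * S P) j a theta r).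
Proof.
move=> Ha Hr.
have HM : (0 < 2 * S P)%nat by lia.
have HMn : (2 * S P = S (2 * P + 1))%nat by lia.
move: (2 * S P)%nat HM HMn => M HM HMn.
have H := is_series_rising_binom k (dft_node M a (r - theta)) (cexp_neq_0 _) (dft_node_Cmod _ _ _ Ha HM).
have {}H := is_series_scal_l (cis (2 * PI * r * (INR j / INR M)) : C_AbsRing) _ _ H.
have {}H := is_series_blocks _ _ (2 * P + 1) H.
apply: is_series_ext H => n.
apply: sum_n_ext => i; eqC.
rewrite -HMn.
change scal with Cmult.
rewrite /dft_val /dft_node cexp_pow.
set N := INR (n * M + i).
have HN : N = INR n * INR M + INR i by rewrite /N plus_INR mult_INR.
have HM0 : INR M <> 0 by apply: not_0_INR; lia.
(* By integrality of [r], the phase e^(2 pi i r N / M) at N = n M + i depends on the residue i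
   only. *)
have Hint : cis (2 * PI * r * INR n) = 1.
  case: Hr => ->.
    have -> : 2 * PI * - INR q * INR n = - (2 * PI * INR (q * n)) by rewrite mult_INR; ring.
    by rewrite cis_opp cis_nat; field.
  have -> : 2 * PI * INR q * INR n = 2 * PI * INR (q * n) by rewrite mult_INR; ring.
  exact: cis_nat.
have -> : forall (x b y : C), (x * (b * y) = b * (x * y))%C by move=> x b y; ring.
rewrite -Cmult_assoc; congr (_ * _)%C.
rewrite -[LHS]Cmult_1_r -Hint /cis -!cexp_plus; congr cexp.
rewrite /Cplus /Cmult /RtoC /=; congr pair; rewrite HN; field => //.
Qed.

(** The frequencies -P, ..., P + 1 form a complete residue system; averaging over them keeps, in
    each block, only the term in the class of [j]. *)
Lemma dft_identity (k P j : nat) (a theta : R) :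
  0 < a -> (j < 2 * S P)%nat ->
  is_series (V := C_NormedModule) (fun n => dft_val k (2 * S P) a theta (n * (2 * S P) + j))
    (sum_n (fun m => / RtoC (INR (2 * S P)) *
       (dft_term k (2 * S P) j a theta (- INR m) + dft_term k (2 * S P) j a theta (INR m + 1)))%C P).
Proof.
move=> Ha Hj.
set M := (2 * S P)%nat.
have HM0 : RtoC (INR M) <> 0.
  move=> H; have := RtoC_inj _ _ H; apply: not_0_INR; rewrite /M; lia.
pose t i := 2 * PI * (INR i - INR j) / INR M.
pose F m n := (/ RtoC (INR M) *
  (sum_n (fun i => dft_val k M a theta (n * M + i) * cis (INR m * t i))%C (2 * P + 1)
  + sum_n (fun i => dft_val k M a theta (n * M + i) * cis (- (INR m + 1) * t i))%C (2 * P + 1)))%C.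
have HF m : is_series (V := C_NormedModule) (F m) (/ RtoC (INR M) *
       (dft_term k M j a theta (- INR m) + dft_term k M j a theta (INR m + 1)))%C.
  have H1 := dft_term_series k P j a theta (- INR m) m Ha (or_introl eq_refl).
  have H2 := dft_term_series k P j a theta (INR m + 1) (S m) Ha ltac:(right; by rewrite S_INR).
  have H := is_series_scal_l (/ RtoC (INR M) : C_AbsRing)%C _ _ (is_series_plus _ _ _ _ H1 H2).
  apply: is_series_ext H => n.
  rewrite /F /t Ropp_involutive //.
have H := is_series_sum_n (V := C_NormedModule) F _ P HF.
apply: is_series_ext H => n.
rewrite /F Csum_scal.
have -> : sum_n (fun m => sum_n (fun i => dft_val k M a theta (n * M + i) * cis (INR m * t i))%C (2 * P + 1)
  + sum_n (fun i => dft_val k M a theta (n * M + i) * cis (- (INR m + 1) * t i))%C (2 * P + 1))%C P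
  = sum_n (fun m => sum_n (fun i => dft_val k M a theta (n * M + i) * (cis (INR m * t i) + cis (- (INR m + 1) * t i)))%C (2 * P + 1)) P.
  apply: sum_n_ext => m; eqC; rewrite -Csum_plus; apply: sum_n_ext => i; eqC; ring.
rewrite (sum_n_switch (G := C_AbelianMonoid)).
have -> : sum_n (fun i => sum_n (fun m => dft_val k M a theta (n * M + i) * (cis (INR m * t i) + cis (- (INR m + 1) * t i)))%C P) (2 * P + 1)
  = sum_n (fun i => if Nat.eqb i j then (RtoC (INR M) * dft_val k M a theta (n * M + j))%C else RtoC 0) (2 * P + 1).
  apply: sum_n_ext_loc => i Hi; eqC.
  rewrite Csum_scal character_sum; try (rewrite -/M /M; lia).
  case: (Nat.eqb_spec i j) => [->|_]; rewrite -/M; ring.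
rewrite Csum_single; last lia.
by rewrite Cmult_assoc Cinv_l // Cmult_1_l.
Qed.

(** * Uniform bounds and limits of the discrete terms *)

Lemma sin_ge_quarter (t : R) : 0 <= t <= PI / 2 -> t / 4 <= sin t.
Proof.
move=> [H0 H1]; have HP := PI_4; have HP0 := PI_RGT_0.
have [H _] := SIN t H0 ltac:(lra).
apply: Rle_trans H.
have E : sin_lb t = t - t ^ 3 / 6 + t ^ 5 / 120 - t ^ 7 / 5040.
  rewrite /sin_lb /sin_approx /sin_term /= !INR_IZR_INZ /=; field.
have H2 : t <= 2 by lra.
have Hsq : 0 <= t * t <= 4 by nra.
have H3 : 0 <= t * (4 - t * t) by apply: Rmult_le_pos; lra.
have H5 : 0 <= t * ((t * t) * (t * t)) * (4 - t * t).
  apply: Rmult_le_pos; last lra.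
  apply: Rmult_le_pos => //; apply: Rmult_le_pos; lra.
rewrite E.
(* The Taylor lower bound is regrouped into terms that are nonnegative because t <= pi/2 <= 2; the
   surviving t / 3 exceeds the t / 4 wanted. *)
have -> : t - t ^ 3 / 6 + t ^ 5 / 120 - t ^ 7 / 5040
  = t / 3 + t * (4 - t * t) / 6 + t * ((t * t) * (t * t)) * (4 - t * t) / 5040 + t * ((t * t) * (t * t)) *  (38 / 5040) by field.
have H6 : 0 <= t * ((t * t) * (t * t)) by apply: Rmult_le_pos => //; apply: Rmult_le_pos; lra.
lra.
Qed.

(** A lower bound for M |1 - e^(-(a + 2 pi i v)/M)| uniform in M = 2 L. The restriction |v| <= L
    keeps the angle B = 2 pi v / M within [-pi, pi], where sin (B/2) is at least linear in B; the
    frequencies are taken symmetric about 0 for this reason. The real part contributes e^(-a) a and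
    the angle e^(-a) m; they combine through a^2 + m^2 >= min(1, a)^2 (m + 1)^2 / 4. *)
Lemma dft_node_lower (L m : nat) (a v : R) : 0 < a -> (0 < L)%nat ->
  INR m <= Rabs v <= INR L ->
  exp (- a) * Rmin 1 a / 2 * (INR m + 1)
  <= Cmod (RtoC (INR (2 * L)) * (1 - dft_node (2 * L) a v)).
Proof.
move=> Ha HL [Hmv HvL].
have HL1 : 1 <= INR L by rewrite -INR_1; apply: le_INR; lia.
have HM : INR (2 * L) = 2 * INR L by rewrite mult_INR INR_2.
rewrite /dft_node HM; set M := 2 * INR L; have HM2 : 2 <= M by rewrite /M; lra.
set A := a / M; set B := 2 * PI * v / M.
have HA : 0 < A by apply: Rdiv_lt_0_compat; lra.
have HAM : M * A = a by rewrite /A; field; lra.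
have HBM : M * B = 2 * PI * v by rewrite /B; field; lra.
have HAa : A <= a by nra.
set e := exp (- A).
have He : 0 < e by exact: exp_pos.
have He1 : e <= 1 by rewrite -exp_0; apply: Rlt_le; apply: exp_increasing; lra.
have Hee : exp (- a) <= e.
  case: (Req_dec A a) => [E|NE]; first by rewrite /e E; lra.
  apply: Rlt_le; apply: exp_increasing; lra.
have He0 := exp_pos (- a).
have H1e : e * A <= 1 - e.
  have H := exp_ineq1_le A.
  have E : e * exp A = 1 by rewrite -exp_plus Rplus_opp_l exp_0.
  nra.
have HP := PI_RGT_0; have HP2 := PI2_1.
have Hsin : (B / 8) ^ 2 <= sin (B / 2) ^ 2.
  have Hb : Rabs B <= PI.
    have -> : B = (2 * PI / M) * v by rewrite /B; field; lra.
    rewrite (Rabs_mult (2 * PI / M) v) (Rabs_pos_eq (2 * PI / M)); last first.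
      apply: Rlt_le; apply: Rdiv_lt_0_compat; lra.
    apply: (Rmult_le_reg_r M); first lra.
    have -> : 2 * PI / M * Rabs v * M = PI * (2 * Rabs v) by field; lra.
    apply: Rmult_le_compat_l; first lra.
    rewrite /M; lra.
  case: (Rle_or_lt 0 B) => HB.
    rewrite Rabs_pos_eq // in Hb.
    have := sin_ge_quarter (B / 2) ltac:(lra); nra.
  rewrite Rabs_left // in Hb.
  have := sin_ge_quarter (- (B / 2)) ltac:(lra); rewrite sin_neg; nra.
(* The identity 1 - 2 e cos B + e^2 = (1 - e)^2 + 4 e sin^2 (B/2) separates the contribution of [a]
   from that of [v]. *)
have Hnorm : Cmod (1 - cexp (- A, - B)) ^ 2 = (1 - e) ^ 2 + 4 * e * sin (B / 2) ^ 2.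
  rewrite Cmod2_alt /cexp /Re /Im /= cos_neg sin_neg -/e.
  have HB2 : B = 2 * (B / 2) by field.
  have E1 := sin2_cos2 B; rewrite /Rsqr in E1.
  have E2 := cos_2a_sin (B / 2); rewrite -HB2 in E2.
  have -> : 4 * e * (sin (B / 2) * (sin (B / 2) * 1)) = 2 * e * (1 - cos B) by rewrite E2; ring.
  nra.
have Hmu : 0 < Rmin 1 a by apply: Rmin_pos; lra.
have Hmu1 := Rmin_l 1 a; have Hmu2 := Rmin_r 1 a.
set mu := Rmin 1 a in Hmu Hmu1 Hmu2 *.
have Hm := pos_INR m.
rewrite Cmod_mult Cmod_RtoC_pos; last lra.
apply: Rsqr_incr_0; rewrite /Rsqr; last 2 first.
- apply: Rmult_le_pos; last lra.
  apply: Rlt_le; apply: Rdiv_lt_0_compat; last lra; exact: Rmult_lt_0_compat.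
- apply: Rmult_le_pos; [lra | exact: Cmod_ge_0].
have -> : forall q, M * q * (M * q) = M * M * q ^ 2 by move=> q; ring.
rewrite Hnorm.
have -> : M * M * ((1 - e) ^ 2 + 4 * e * sin (B / 2) ^ 2) = (M * (1 - e)) ^ 2 + 4 * e * ((M * M) * sin (B / 2) ^ 2) by ring.
have G1 : exp (- a) * a <= M * (1 - e).
  apply: (Rle_trans _ (e * a)); first by apply: Rmult_le_compat_r; lra.
  rewrite -HAM -Rmult_assoc [e * M]Rmult_comm Rmult_assoc; apply: Rmult_le_compat_l; lra.
have G2 : v ^ 2 / 4 <= M * M * sin (B / 2) ^ 2.
  apply: (Rle_trans _ (M * M * (B / 8) ^ 2)); last by apply: Rmult_le_compat_l => //; nra.
  have -> : M * M * (B / 8) ^ 2 = (M * B) ^ 2 / 64 by field.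
  rewrite HBM.
  have : 4 <= PI ^ 2 by nra.
  have : 0 <= v ^ 2 by nra.
  nra.
have G3 : INR m ^ 2 <= v ^ 2.
  rewrite -(pow2_abs v); apply: pow_incr; lra.
set E := exp (- a) in He0 Hee G1 *.
have G4 : (E * a) ^ 2 <= (M * (1 - e)) ^ 2 by apply: pow_incr; nra.
have G5 : E * E * INR m ^ 2 <= 4 * e * (M * M * sin (B / 2) ^ 2).
  apply: (Rle_trans _ (e * v ^ 2)); last nra.
  apply: Rmult_le_compat => //; nra.
apply: (Rle_trans _ ((E * a) ^ 2 + E * E * INR m ^ 2)); last lra.
have -> : (E * a) ^ 2 + E * E * INR m ^ 2 = E * E * (a ^ 2 + INR m ^ 2) by ring.
have -> : E * mu / 2 * (INR m + 1) * (E * mu / 2 * (INR m + 1)) = E * E * (mu ^ 2 * (INR m + 1) ^ 2 / 4) by field.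
apply: Rmult_le_compat_l; first nra.
have K1 : mu ^ 2 <= a ^ 2 by apply: pow_incr; lra.
have K2 : mu ^ 2 <= 1 by nra.
have K3 : mu ^ 2 * INR m ^ 2 <= INR m ^ 2 by nra.
nra.
Qed.

Lemma is_lim_seq_derive (g : R -> R) (d : R) (h : nat -> R) :
  is_derive g 0 d -> is_lim_seq h 0 -> (forall n, h n <> 0) ->
  is_lim_seq (fun n => / h n * (g (h n) - g 0)) d.
Proof.
move=> /is_derive_Reals Hg Hh Hn; apply/is_lim_seq_spec => eps.
have [delta Hd] := Hg eps (cond_pos eps).
have /is_lim_seq_spec/(_ delta) [N HN] := Hh.
exists N => n Hn'.
have H1 := HN n Hn'; rewrite Rminus_0_r in H1.
have := Hd (h n) (Hn n) H1; rewrite Rplus_0_l.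
by rewrite /Rdiv Rmult_comm.
Qed.

Lemma is_lim_seq_inv_even : is_lim_seq (fun P => / INR (2 * S P)) 0.
Proof.
apply: (is_lim_seq_le_le (fun _ => 0) _ (fun P => / INR (S P))).
- move=> P; have H : 0 < INR (S P) by apply: lt_0_INR; lia.
  rewrite mult_INR INR_2; split.
    apply: Rlt_le; apply: Rinv_0_lt_compat; lra.
  apply: Rinv_le_contravar; lra.
- exact: is_lim_seq_const.
- have := is_lim_seq_inv INR p_infty is_lim_seq_INR ltac:(by []).
  by move/is_lim_seq_incr_1.
Qed.

Lemma INR_even_pos (P : nat) : 0 < INR (2 * S P).
Proof. apply: lt_0_INR; lia. Qed.

(** With w = a + 2 pi i v, the limit is the derivative at 0 of - e^(-w t), taken coordinatewise
    along t = 1 / M. *)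
Lemma dft_node_lim (a v : R) :
  clim (fun P => RtoC (INR (2 * S P)) * (1 - dft_node (2 * S P) a v))%C (a, 2 * PI * v).
Proof.
have Hh P : / INR (2 * S P) <> 0.
  apply: Rgt_not_eq; apply: Rinv_0_lt_compat; exact: INR_even_pos.
apply: (clim_ext (fun P => (/ / INR (2 * S P) * ((- exp (- (a * / INR (2 * S P))) * cos (- (2 * PI * v * / INR (2 * S P)))) - (- exp (- (a * 0)) * cos (- (2 * PI * v * 0)))),
  / / INR (2 * S P) * ((- exp (- (a * / INR (2 * S P))) * sin (- (2 * PI * v * / INR (2 * S P)))) - (- exp (- (a * 0)) * sin (- (2 * PI * v * 0))))))).
  move=> P; rewrite !Rmult_0_r Ropp_0 exp_0 cos_0 sin_0 Rinv_inv.
  rewrite /dft_node /cexp /Cminus /Cmult /Cplus /Copp /RtoC /Re /Im /=; congr pair; rewrite /Rdiv; ring.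
apply: clim_pair.
- apply: (is_lim_seq_derive (fun t => - exp (- (a * t)) * cos (- (2 * PI * v * t)))) => //; last exact: is_lim_seq_inv_even.
  auto_derive => //; rewrite !Rmult_0_r Ropp_0 exp_0 cos_0 sin_0; ring.
- apply: (is_lim_seq_derive (fun t => - exp (- (a * t)) * sin (- (2 * PI * v * t)))) => //; last exact: is_lim_seq_inv_even.
  auto_derive => //; rewrite !Rmult_0_r Ropp_0 exp_0 cos_0 sin_0; ring.
Qed.

Lemma pow_exp_neg_le (k : nat) (p b : R) : 0 < p -> 0 < b ->
  exists K, 0 < K /\ forall x, 0 < x -> x ^ k * exp (- (b * x)) <= K * Rpower x (- p).
Proof.
move=> Hp Hb; set q := INR k + p; have Hk := pos_INR k.
exists (Rpower q q * Rpower b (- q)); split.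
  by apply: Rmult_lt_0_compat; exact: Rpower_pos.
move=> x Hx.
have H := exp_neg_le_Rpower q (b * x) ltac:(rewrite /q; lra) (Rmult_lt_0_compat _ _ Hb Hx).
rewrite -Rpower_mult_distr // in H.
have -> : Rpower q q * Rpower b (- q) * Rpower x (- p)
  = x ^ k * (Rpower q q * (Rpower b (- q) * Rpower x (- q))).
  rewrite -(Rpower_pow k x) //.
  have -> : Rpower x (- p) = Rpower x (INR k) * Rpower x (- q).
    rewrite -Rpower_plus; congr Rpower; rewrite /q; ring.
  ring.
apply: Rmult_le_compat_l => //; apply: pow_le; lra.
Qed.

Lemma ex_series_le_pos (a b : nat -> R) :
  (forall n, 0 <= a n <= b n) -> ex_series b -> ex_series a.
Proof.
move=> H; apply: ex_series_le => n.
change (Rabs (a n) <= b n); rewrite Rabs_pos_eq; by case: (H n).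
Qed.

Lemma ex_series_pow_exp (k : nat) (a c : R) : 0 < a -> 1 <= c ->
  ex_series (fun n => (INR n + c) ^ k * exp (- (a * INR n))).
Proof.
move=> Ha Hc.
have [K [HK H]] := pow_exp_neg_le k 2 a ltac:(lra) Ha.
apply: (ex_series_le_pos _ (fun n => (exp (a * c) * K) * Rpower (INR n + 1) (Ropp 2))).
  move=> n; have Hn := pos_INR n; split.
    apply: Rmult_le_pos; [apply: pow_le; lra | exact: Rlt_le (exp_pos _)].
  have -> : exp (- (a * INR n)) = exp (a * c) * exp (- (a * (INR n + c))).
    rewrite -exp_plus; congr exp; ring.
  have Hx : 0 < INR n + c by lra.
  have H1 := H _ Hx.
  have H2 := Rpower_neg_le (INR n + 1) (INR n + c) 2 ltac:(lra) ltac:(lra).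
  have He := exp_pos (a * c).
  have -> : (INR n + c) ^ k * (exp (a * c) * exp (- (a * (INR n + c))))
    = exp (a * c) * ((INR n + c) ^ k * exp (- (a * (INR n + c)))) by ring.
  rewrite Rmult_assoc; apply: Rmult_le_compat_l; first lra.
  apply: Rle_trans H1 _; apply: Rmult_le_compat_l; lra.
apply: (ex_series_scal_l (K := R_AbsRing)); apply: (ex_series_Rpower 2); lra.
Qed.

Lemma rising_binom_lim (k : nat) (N M : nat -> nat) (u : R) :
  (forall P, 0 < INR (M P)) ->
  is_lim_seq (fun P => / INR (M P)) 0 -> is_lim_seq (fun P => INR (N P) / INR (M P)) u ->
  is_lim_seq (fun P => rising_binom k (INR (N P)) / INR (M P) ^ k) (u ^ k / INR (fact k)).
Proof.
move=> HM H0 Hu; elim: k => [|k IH].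
  rewrite /rising_binom /=; have -> : 1 / INR 1 = 1 by rewrite INR_1; field.
  apply: (is_lim_seq_ext (fun _ => 1)); last exact: is_lim_seq_const.
  move=> n; field.
have Hk := pos_INR k.
have Hf := INR_fact_neq_0 k.
apply: (is_lim_seq_ext (fun P => rising_binom k (INR (N P)) / INR (M P) ^ k *
  ((INR (N P) / INR (M P) + INR (S k) * / INR (M P)) * / INR (S k)))).
  move=> P; rewrite rising_binomS /= S_INR; field; have HMP := HM P; repeat split; try lra.
  apply: pow_nonzero; lra.
have -> : u ^ S k / INR (fact (S k)) = u ^ k / INR (fact k) * ((u + INR (S k) * 0) * / INR (S k)).
  rewrite fact_simpl mult_INR S_INR /=; field; split => //; lra.
apply: is_lim_seq_mult' => //; apply: is_lim_seq_mult'; last exact: is_lim_seq_const.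
apply: is_lim_seq_plus' => //; apply: is_lim_seq_mult' => //; exact: is_lim_seq_const.
Qed.

(* a + 2 pi i v *)
Definition pole (a v : R) : C := (a, 2 * PI * v).

Lemma pole_neq_0 (a v : R) : 0 < a -> pole a v <> 0.
Proof. move=> Ha [H _]; lra. Qed.

Lemma dft_term_lim (k : nat) (j : nat -> nat) (a theta psi r : R) : 0 < a ->
  is_lim_seq (fun P => INR (j P) / INR (2 * S P)) psi ->
  clim (fun P => / RtoC (INR (2 * S P)) ^ S k * dft_term k (2 * S P) (j P) a theta r)%C
    (cis (2 * PI * r * psi) * / pole a (r - theta) ^ S k)%C.
Proof.
move=> Ha Hj.
apply: (clim_ext (fun P => cis (2 * PI * r * (INR (j P) / INR (2 * S P))) *
   / (RtoC (INR (2 * S P)) * (1 - dft_node (2 * S P) a (r - theta))) ^ S k)%C).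
  move=> P; rewrite /dft_term Cpow_mult_l.
  have H1 : (RtoC (INR (2 * S P)) ^ S k)%C <> 0.
    apply: Cpow_nz => /RtoC_inj; exact: Rgt_not_eq (INR_even_pos P).
  have H2 : ((1 - dft_node (2 * S P) a (r - theta)) ^ S k)%C <> 0.
    apply: Cpow_nz => H.
    have := dft_node_Cmod (2 * S P) a (r - theta) Ha ltac:(lia).
    have -> : dft_node (2 * S P) a (r - theta) = RtoC 1.
      rewrite -[LHS]Cplus_0_r -H; ring.
    rewrite Cmod_1; lra.
  by field.
apply: clim_mult.
  apply: clim_cexp; apply: clim_pair; first exact: is_lim_seq_const.
  apply: is_lim_seq_mult' => //; exact: is_lim_seq_const.
apply: clim_inv.
  exact: Cpow_nz (pole_neq_0 _ _ Ha).
apply: clim_pow; exact: dft_node_lim.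
Qed.

Lemma dft_term_bound (k P m j : nat) (a theta r : R) : 0 < a ->
  INR m <= Rabs (r - theta) <= INR (S P) ->
  Cmod (/ RtoC (INR (2 * S P)) ^ S k * dft_term k (2 * S P) j a theta r)
  <= / (exp (- a) * Rmin 1 a / 2 * (INR m + 1)) ^ S k.
Proof.
move=> Ha Hv.
have Hlow := dft_node_lower (S P) m a (r - theta) Ha ltac:(lia) Hv.
have Hc : 0 < exp (- a) * Rmin 1 a / 2 * (INR m + 1).
  have Hm := pos_INR m; have He := exp_pos (- a).
  have Hmin : 0 < Rmin 1 a by apply: Rmin_pos; lra.
  apply: Rmult_lt_0_compat; last lra.
  apply: Rdiv_lt_0_compat; last lra; exact: Rmult_lt_0_compat.
set D := (RtoC (INR (2 * S P)) * (1 - dft_node (2 * S P) a (r - theta)))%C in Hlow.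
have HD : 0 < Cmod D by lra.
have HM : RtoC (INR (2 * S P)) <> 0.
  move=> /RtoC_inj; exact: Rgt_not_eq (INR_even_pos P).
have HD0 : D <> 0 by apply/Cmod_gt_0.
have -> : (/ RtoC (INR (2 * S P)) ^ S k * dft_term k (2 * S P) j a theta r
  = cis (2 * PI * r * (INR j / INR (2 * S P))) * / D ^ S k)%C.
  rewrite /dft_term /D Cpow_mult_l; field; split; apply: Cpow_nz => //.
  move=> H; apply: HD0; rewrite /D H; ring.
rewrite Cmod_mult /cis Cmod_cexp [Re _]/= exp_0 Rmult_1_l Cmod_inv; last exact: Cpow_nz.
rewrite Cmod_pow.
apply: Rinv_le_contravar; first exact: pow_lt.
apply: pow_incr; lra.
Qed.

Ltac normC := match goal with |- norm ?x <= ?y => change (Cmod x <= y) end.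

(** The formula at z = a - 2 pi i theta, with the frequencies paired as -m and m + 1 to turn the
    bilateral sum into one series. Both series are limits of the same sequence [s], hence the
    existential sum. From k >= 1 the poles have order at least 2, which makes the majorant of the
    paired terms summable. *)
Lemma lipschitz (k : nat) (a theta psi : R) : (1 <= k)%nat -> 0 < a ->
  0 <= theta < 1 -> 0 <= psi < 1 -> exists l,
  is_series (V := C_NormedModule) (fun m =>
    cis (2 * PI * (- INR m) * psi) * / pole a (- INR m - theta) ^ S k +
    cis (2 * PI * (INR m + 1) * psi) * / pole a (INR m + 1 - theta) ^ S k)%C l /\
  is_series (V := C_NormedModule) (fun n =>
    RtoC ((INR n + psi) ^ k / INR (fact k)) *
      cexp ((- (a * (INR n + psi)))%R, (2 * PI * theta * (INR n + psi))%R))%C l.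
Proof.
move=> Hk Ha Ht Hp.
have HMpos P := INR_even_pos P.
have HM0 (P i : nat) : (RtoC (INR (2 * S P)) ^ i)%C <> 0.
  apply: Cpow_nz => /RtoC_inj; exact: Rgt_not_eq (HMpos P).
(* The residue floor(psi M): it lies below M since psi < 1, and j / M tends to psi. *)
pose j P := proj1_sig (nfloor_ex (psi * INR (2 * S P)) ltac:(apply: Rmult_le_pos; [lra | exact: Rlt_le])).
have Hj P : INR (j P) <= psi * INR (2 * S P) < INR (j P) + 1.
  exact: (proj2_sig (nfloor_ex (psi * INR (2 * S P)) _)).
have HjM P : (j P < 2 * S P)%nat.
  apply: INR_lt; have := Hj P; have := HMpos P; nra.
have Hjlim : is_lim_seq (fun P => INR (j P) / INR (2 * S P)) psi.
  apply: (is_lim_seq_le_le (fun P => psi - / INR (2 * S P)) _ (fun _ => psi)).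
  - move=> P; have := Hj P; have HP := HMpos P => -[H1 H2]; split.
      apply: (Rmult_le_reg_r (INR (2 * S P))) => //.
      have -> : INR (j P) / INR (2 * S P) * INR (2 * S P) = INR (j P) by field; lra.
      have -> : (psi - / INR (2 * S P)) * INR (2 * S P) = psi * INR (2 * S P) - 1 by field; lra.
      lra.
    apply: (Rmult_le_reg_r (INR (2 * S P))) => //.
    have -> : INR (j P) / INR (2 * S P) * INR (2 * S P) = INR (j P) by field; lra.
    lra.
  - have H := is_lim_seq_minus' _ _ _ _ (is_lim_seq_const psi) is_lim_seq_inv_even.
    by rewrite Rminus_0_r in H.
  - exact: is_lim_seq_const.
(* common value of the two sides at level P *)
pose T m P := (/ RtoC (INR (2 * S P)) ^ S k *
   (dft_term k (2 * S P) (j P) a theta (- INR m) + dft_term k (2 * S P) (j P) a theta (INR m + 1)))%C.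
pose s P := sum_n (fun m => T m P) P.
set c := exp (- a) * Rmin 1 a / 2.
have Hc : 0 < c.
  have He := exp_pos (- a).
  have Hmin : 0 < Rmin 1 a by apply: Rmin_pos; lra.
  apply: Rdiv_lt_0_compat; last lra; exact: Rmult_lt_0_compat.
set lhs := fun m : nat => (_ + _)%C.
set rhs := fun n : nat => (_ * _)%C.
(* The sum over m <= P is padded with zeros to a full series. For those m, both m + theta and m + 1
   - theta lie between m and P + 1, half the modulus, as the lower bound requires. *)
have [l1 [Hl1 Hs1]] : exists l, is_series (V := C_NormedModule) lhs l /\ clim s l.
  apply: (series_dominated (V := C_CompleteNormedModule)
    (fun m P => if Nat.leb m P then T m P else RtoC 0)
    (fun m => 2 * / c ^ S k * Rpower (INR m + 1) (Ropp 2))).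
  - apply: (ex_series_scal_l (K := R_AbsRing)); apply: (ex_series_Rpower 2); lra.
  - move=> m P; normC.
    have Hm := pos_INR m.
    have Hb : 0 < c ^ S k by apply: pow_lt.
    case: (Nat.leb_spec m P) => HmP; last first.
      rewrite Cmod_0; apply: Rmult_le_pos; last exact: Rlt_le (Rpower_pos _ _).
      apply: Rlt_le; apply: Rmult_lt_0_compat; [lra | exact: Rinv_0_lt_compat].
    have HmPR : INR m + 1 <= INR (S P) by rewrite S_INR; have := le_INR _ _ HmP; lra.
    have H1 := dft_term_bound k P m (j P) a theta (- INR m) Ha ltac:(rewrite Rabs_left1; lra).
    have H2 := dft_term_bound k P m (j P) a theta (INR m + 1) Ha ltac:(rewrite Rabs_pos_eq; lra).
    rewrite -/c in H1 H2.
    have H3 : / (c * (INR m + 1)) ^ S k <= / c ^ S k * Rpower (INR m + 1) (Ropp 2).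
      rewrite Rpow_mult_distr Rinv_mult; apply: Rmult_le_compat_l.
        apply: Rlt_le; exact: Rinv_0_lt_compat.
      rewrite Rpower_Ropp; apply: Rinv_le_contravar; first exact: Rpower_pos.
      rewrite -(Rpower_pow (S k)); last lra.
      apply: Rle_Rpower; first lra.
      rewrite -INR_2; apply: le_INR; lia.
    rewrite /T Cmult_plus_distr_l; apply: Rle_trans (Cmod_triangle _ _) _; lra.
  - move=> m.
    have H := clim_plus _ _ _ _ (dft_term_lim k j a theta psi (- INR m) Ha Hjlim)
       (dft_term_lim k j a theta psi (INR m + 1) Ha Hjlim).
    apply: filterlim_ext_loc H; exists m => P HmP.
    by rewrite (proj2 (Nat.leb_le _ _) HmP) /T Cmult_plus_distr_l.
  - move=> P.
    have -> : s P = sum_n (fun m => if Nat.leb m P then T m P else RtoC 0) P.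
      apply: sum_n_ext_loc => m Hm; by rewrite (proj2 (Nat.leb_le _ _) Hm).
    apply: (is_series_finite (V := C_NormedModule)) => n Hn.
    by case: (Nat.leb_spec n P) => // H; lia.
(* The same [s P] as a sum over N = n M + j, that is over u = n + j / M. Its majorant comes from (N
   + k) / M <= n + 1 + k. *)
have [l2 [Hl2 Hs2]] : exists l, is_series (V := C_NormedModule) rhs l /\ clim s l.
  apply: (series_dominated (V := C_CompleteNormedModule)
    (fun n P => / RtoC (INR (2 * S P)) ^ k * dft_val k (2 * S P) a theta (n * (2 * S P) + j P))%C
    (fun n => (INR n + (1 + INR k)) ^ k * exp (- (a * INR n)))).
  - apply: ex_series_pow_exp => //; have := pos_INR k; lra.
  - move=> n P; normC; rewrite Cmod_mult /dft_val Cmod_mult Cmod_cexp.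
    have Hn := pos_INR n; have HP := HMpos P.
    rewrite Cmod_inv // Cmod_pow [Cmod (INR (2 * S P))]Cmod_RtoC_pos; last lra.
    rewrite Cmod_RtoC_pos; last exact: Rlt_le (rising_binom_pos _ _ (pos_INR _)).
    have Hjp := pos_INR (j P); have HjP : INR (j P) <= INR (2 * S P).
      by apply: le_INR; have := HjM P; lia.
    have HM1 : 1 <= INR (2 * S P) by rewrite -INR_1; apply: le_INR; lia.
    rewrite -Rmult_assoc; apply: Rmult_le_compat.
    + apply: Rmult_le_pos; last exact: Rlt_le (rising_binom_pos _ _ (pos_INR _)).
      apply: Rlt_le; apply: Rinv_0_lt_compat; exact: pow_lt.
    + exact: Rlt_le (exp_pos _).
    + apply: (Rmult_le_reg_l (INR (2 * S P) ^ k)); first exact: pow_lt.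
      rewrite -Rmult_assoc Rinv_r; last by apply: pow_nonzero; lra.
      rewrite Rmult_1_l -Rpow_mult_distr.
      apply: Rle_trans (rising_binom_le _ _ (pos_INR _)) _.
      apply: pow_incr; split; first by have := pos_INR (n * (2 * S P) + j P); have := pos_INR k; lra.
      rewrite plus_INR mult_INR; have := pos_INR k; nra.
    + rewrite /=.
      have -> : INR (n * (2 * S P) + j P) / INR (2 * S P) = INR n + INR (j P) / INR (2 * S P).
        rewrite plus_INR mult_INR; field; lra.
      have H0 : 0 <= INR (j P) / INR (2 * S P) by apply: Rdiv_le_0_compat.
      set u := INR (j P) / _ in H0 *.
      have : - (a * (INR n + u)) <= - (a * INR n) by nra.
      case=> [H|->]; [exact: Rlt_le (exp_increasing _ _ H) | exact: Rle_refl].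
  - move=> n.
    have Hlim : is_lim_seq (fun P => INR (n * (2 * S P) + j P) / INR (2 * S P)) (INR n + psi).
      apply: (is_lim_seq_ext (fun P => INR n + INR (j P) / INR (2 * S P))).
        move=> P; have HP := HMpos P; rewrite (plus_INR (n * _)) (mult_INR n); field; lra.
      apply: is_lim_seq_plus' => //; exact: is_lim_seq_const.
    have H1 := rising_binom_lim k (fun P => n * (2 * S P) + j P)%nat (fun P => 2 * S P)%nat _ HMpos is_lim_seq_inv_even Hlim.
    apply: (clim_ext (fun P => RtoC (rising_binom k (INR (n * (2 * S P) + j P)) / INR (2 * S P) ^ k) *
       cexp ((- (a * (INR (n * (2 * S P) + j P) / INR (2 * S P))))%R, (2 * PI * theta * (INR (n * (2 * S P) + j P) / INR (2 * S P)))%R))%C).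
      move=> P; have HP := HMpos P.
      rewrite /dft_val RtoC_div ?RtoC_pow; last by apply: pow_nonzero; lra.
      field; exact: HM0.
    apply: clim_mult; first exact: clim_RtoC.
    apply: clim_cexp; apply: clim_pair.
      apply: (is_lim_seq_ext (fun P => (- a) * (INR (n * (2 * S P) + j P) / INR (2 * S P)))).
        move=> P; ring.
      rewrite Ropp_mult_distr_l; apply: is_lim_seq_mult' => //; exact: is_lim_seq_const.
    apply: is_lim_seq_mult' => //; exact: is_lim_seq_const.
  - move=> P.
    have H := is_series_scal_l (/ RtoC (INR (2 * S P)) ^ k : C_AbsRing)%C _ _ (dft_identity k P (j P) a theta Ha (HjM P)).
    suff -> : s P = scal (/ RtoC (INR (2 * S P)) ^ k : C_AbsRing)%C (sum_n (fun m => / RtoC (INR (2 * S P)) *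
         (dft_term k (2 * S P) (j P) a theta (- INR m) + dft_term k (2 * S P) (j P) a theta (INR m + 1)))%C P) by exact: H.
    change scal with Cmult; rewrite -Csum_scal; apply: sum_n_ext => m; eqC.
    have H1 := HM0 P k; have H2 := HM0 P 1%nat; rewrite Cpow_1_r in H2.
    rewrite /T Cpow_S; field; split => //.
exists l1; split => //.
have -> : l1 = l2 by apply: (clim_unique s).
exact: Hl2.
Qed.

(** * Transformation of the Lambert-type series *)

Lemma sum_n_extend {G : AbelianMonoid} (a : nat -> G) (N X : nat) :
  (forall i, (N < i)%nat -> a i = zero) -> (N <= X)%nat -> sum_n a X = sum_n a N.
Proof.
move=> H; elim: X => [|X IH] HX; first by have -> : N = 0%nat by lia.
case: (Nat.eq_dec N (S X)) => [-> //|Hne].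
rewrite sum_Sn IH ?H ?plus_zero_r //; lia.
Qed.

Lemma Rsum_single (a : R) (j n : nat) :
  sum_n (fun i => if Nat.eqb i j then a else 0) n = if Nat.leb j n then a else 0.
Proof.
elim: n => [|n IH].
  rewrite sum_O; by case: j.
rewrite sum_Sn IH.
match goal with |- plus ?x ?y = ?z => change (Rplus x y = z) end.
case: (Nat.eqb_spec (S n) j) => H1; case: (Nat.leb_spec j n) => H2; case: (Nat.leb_spec j (S n)) => H3; try lia; ring.
Qed.

(** A cutoff [X] common to all [N] turns the divisor sum into a sum over a square, which can be
    exchanged with the sum over [N]. The factors are written as successors because both are at least
    1. *)
Lemma divisor_sum_as_double (F : nat -> nat -> R) (N X : nat) : (N <= X)%nat ->
  sum_n_m (fun d => if Nat.eqb (S N mod d) 0 then F d (S N / d)%nat else 0) 1 (S N)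
  = sum_n (fun i => sum_n (fun j => if Nat.eqb (S i * S j) (S N) then F (S i) (S j) else 0) X) X.
Proof.
move=> HX.
rewrite -(sum_n_m_S (fun d => if Nat.eqb (S N mod d) 0 then F d (S N / d)%nat else 0)).
change (sum_n (fun i => if Nat.eqb (S N mod S i) 0 then F (S i) (S N / S i)%nat else 0) N
  = sum_n (fun i => sum_n (fun j => if Nat.eqb (S i * S j) (S N) then F (S i) (S j) else 0) X) X).
rewrite -(sum_n_extend (fun i => if Nat.eqb (S N mod S i) 0 then F (S i) (S N / S i)%nat else 0) N X) //; last first.
  move=> i Hi; rewrite Nat.mod_small; last lia.
  by [].
apply: sum_n_ext => i; eqR.
case: (Nat.eqb_spec (S N mod S i) 0) => Hd.
  have E : S N = (S i * (S N / S i))%nat by apply/Nat.Div0.div_exact.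
  set q := (S N / S i)%nat in E *.
  have Hq : (1 <= q)%nat by case: (q) E => //; lia.
  have -> : sum_n (fun j => if Nat.eqb (S i * S j) (S N) then F (S i) (S j) else 0) X
    = sum_n (fun j => if Nat.eqb j (q - 1) then F (S i) q else 0) X.
    apply: sum_n_ext => j.
    case: (Nat.eqb_spec j (q - 1)) => Hj.
      have -> : S j = q by lia.
      by rewrite -E Nat.eqb_refl.
    case: (Nat.eqb_spec (S i * S j) (S N)) => // H; exfalso; apply: Hj.
    have : S j = q by rewrite E in H; nia.
    lia.
  rewrite Rsum_single; case: Nat.leb_spec => // H; exfalso; nia.
rewrite (sum_n_ext _ (fun _ => zero)); last first.
  move=> j; case: (Nat.eqb_spec (S i * S j) (S N)) => // H; exfalso; apply: Hd.
  by rewrite -H Nat.mul_comm Nat.Div0.mod_mul.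
by rewrite /sum_n sum_n_m_const_zero.
Qed.

(** The partial divisor sums run over the pairs with product at most X + 1. Their indicator tends to
    1 pointwise, so Tannery's theorem applies, for the inner sum over [i] and then for the sum over
    [j]. *)
Lemma is_series_divisors (F : nat -> nat -> R) (A B G : nat -> R) :
  ex_series A -> ex_series B -> (forall j, 0 <= A j) -> (forall i, 0 <= B i) ->
  (forall i j, Rabs (F (S i) (S j)) <= A j * B i) ->
  (forall j, is_series (fun i => F (S i) (S j)) (G j)) ->
  exists L, is_series G L /\
  is_series (fun N => sum_n_m (fun d => if Nat.eqb (S N mod d) 0 then F d (S N / d)%nat else 0) 1 (S N)) L.
Proof.
move=> HA HB A0 B0 HF HG.
pose T j i X := if Nat.leb (S i * S j) (S X) then F (S i) (S j) else 0.
pose a j X := sum_n (fun i => T j i X) X.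
have HT i j X : Rabs (T j i X) <= A j * B i.
  rewrite /T; case: Nat.leb; first exact: HF.
  rewrite Rabs_R0; exact: Rmult_le_pos.
have HBj j : ex_series (fun i => A j * B i) by apply: (ex_series_scal_l (K := R_AbsRing)).
have Ha j X : is_series (fun i => T j i X) (a j X).
  apply: is_series_finite => i Hi; rewrite /T.
  case: Nat.leb_spec => // H; exfalso; nia.
apply: (series_dominated (V := R_CompleteNormedModule) a (fun j => A j * Series B) G).
- exact: ex_series_scal_r.
- move=> j X; rewrite -Series_scal_l.
  apply: (norm_series_le (V := R_CompleteNormedModule) _ _ _ _ (HBj j) (Ha j X)) => i; exact: (HT i j X).
- move=> j.
  have [l [H1 H2]] : exists l, is_series (fun i => F (S i) (S j)) l /\ filterlim (a j) eventually (locally l).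
    apply: (series_dominated (V := R_CompleteNormedModule) (T j) (fun i => A j * B i)).
    - exact: HBj.
    - move=> i X; exact: (HT i j X).
    - move=> i; apply: (filterlim_ext_loc (fun _ => F (S i) (S j))); last exact: filterlim_const.
      exists (S i * S j)%nat => X HX; rewrite /T.
      case: Nat.leb_spec => // H; lia.
    - exact: Ha.
  by rewrite (is_series_unique_V _ _ _ (HG j) H1).
- move=> X.
  have -> : sum_n (fun N => sum_n_m (fun d => if Nat.eqb (S N mod d) 0 then F d (S N / d)%nat else 0) 1 (S N)) X
    = sum_n (fun j => a j X) X.
    rewrite (sum_n_ext_loc _ (fun N => sum_n (fun i => sum_n (fun j => if Nat.eqb (S i * S j) (S N) then F (S i) (S j) else 0) X) X)); last first.
      move=> N HN; exact: divisor_sum_as_double.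
    rewrite sum_n_switch /a [in RHS]sum_n_switch.
    apply: sum_n_ext => i; rewrite sum_n_switch.
    apply: sum_n_ext => j; eqR.
    have -> : sum_n (fun N => if Nat.eqb (S i * S j) (S N) then F (S i) (S j) else 0) X
      = sum_n (fun N => if Nat.eqb N (S i * S j - 1) then F (S i) (S j) else 0) X.
      apply: sum_n_ext => N.
      case: (Nat.eqb_spec (S i * S j) (S N)) => H1; case: (Nat.eqb_spec N (S i * S j - 1)) => H2 //; lia.
    rewrite Rsum_single /T.
    case: Nat.leb_spec => H1; case: Nat.leb_spec => H2 //; lia.
  apply: is_series_finite => j Hj; rewrite /a /sum_n -(sum_n_m_const_zero 0 X).
  apply: sum_n_m_ext => i; rewrite /T; case: Nat.leb_spec => // H; exfalso; nia.
Qed.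

Lemma is_series_Re (u : nat -> C) (l : C) :
  is_series (V := C_NormedModule) u l -> is_series (fun n => Re (u n)) (Re l).
Proof.
move=> H; apply: (filterlim_ext (fun N => Re (sum_n u N))).
  elim=> [|N IH]; first by rewrite !sum_O.
  by rewrite Csum_S sum_Sn -IH.
exact: (filterlim_Re eventually _ _ H).
Qed.

(** * Sums over poles *)

Definition inv_pole (k : nat) (a v : R) : C := (/ pole a v ^ S k)%C.

Lemma inv_pole_opp (k : nat) (a v : R) : 0 < a -> inv_pole k a (- v) = Cconj (inv_pole k a v).
Proof.
move=> Ha; rewrite /inv_pole Cinv_conj; last exact: Cpow_nz (pole_neq_0 _ _ Ha).
rewrite Cpow_conj; congr (/ _ ^ _)%C.
rewrite /pole /Cconj /=; congr pair; ring.
Qed.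

Lemma Re_inv_pole_opp (k : nat) (a v : R) : 0 < a -> Re (inv_pole k a (- v)) = Re (inv_pole k a v).
Proof. by move=> Ha; rewrite inv_pole_opp. Qed.

Lemma Im_inv_pole_opp (k : nat) (a v : R) : 0 < a -> Im (inv_pole k a (- v)) = - Im (inv_pole k a v).
Proof. by move=> Ha; rewrite inv_pole_opp. Qed.

(** Since |a + 2 pi i v|^2 = a^2 + (2 pi v)^2 >= a v, three of the k + 1 factors give (a v)^(3/2),
    and the other k - 2 are bounded below by a. The exponent 3/2 > 1 is summable in each
    variable. *)
Lemma Cmod_inv_pole_le (k : nat) (a v : R) : (2 <= k)%nat -> 0 < a -> 0 < v ->
  Cmod (inv_pole k a v) <= / a ^ (k - 2) * Rpower (a * v) (- (3 / 2)).
Proof.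
move=> Hk Ha Hv; rewrite /inv_pole Cmod_inv; last exact: Cpow_nz (pole_neq_0 _ _ Ha).
rewrite Cmod_pow Rpower_Ropp -Rinv_mult.
have HP := PI2_1.
have Hav : 0 < a * v by exact: Rmult_lt_0_compat.
have H2 : Cmod (pole a v) ^ 2 = a ^ 2 + (2 * PI * v) ^ 2 by rewrite Cmod2_alt.
have Hm : a <= Cmod (pole a v).
  have := re_le_Cmod (pole a v); rewrite /= Rabs_pos_eq //; lra.
have Hsq : a * v <= Cmod (pole a v) ^ 2.
  rewrite H2; have : 0 <= (a - v) ^ 2 by exact: pow2_ge_0.
  have : v ^ 2 <= (2 * PI * v) ^ 2 by apply: pow_incr; split; nra.
  nra.
apply: Rinv_le_contravar.
  apply: Rmult_lt_0_compat; [exact: pow_lt | exact: Rpower_pos].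
have -> : (S k = (k - 2) + 3)%nat by lia.
rewrite pow_add; apply: Rmult_le_compat.
- apply: Rlt_le; exact: pow_lt.
- exact: Rlt_le (Rpower_pos _ _).
- apply: pow_incr; lra.
- have -> : Cmod (pole a v) ^ 3 = Rpower (Cmod (pole a v) ^ 2) (3 / 2).
    rewrite -(Rpower_pow 2); last lra.
    rewrite Rpower_mult INR_2.
    have -> : 2 * (3 / 2) = INR 3 by rewrite /INR; field.
    rewrite Rpower_pow //; lra.
  apply: Rle_Rpower_l; lra.
Qed.

Lemma ex_series_Rpower_shift (p c : R) : 1 < p -> 0 < c ->
  ex_series (fun n => Rpower (INR n + c) (- p)).
Proof.
move=> Hp Hc; set mu := Rmin 1 c.
have Hmu : 0 < mu by apply: Rmin_pos; lra.
have H1 := Rmin_l 1 c; have H2 := Rmin_r 1 c; rewrite -/mu in H1 H2.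
apply: (ex_series_le_pos _ (fun n => Rpower mu (- p) * Rpower (INR n + 1) (- p))).
  move=> n; have Hn := pos_INR n; split; first exact: Rlt_le (Rpower_pos _ _).
  rewrite Rpower_mult_distr; try lra.
  apply: Rpower_neg_le; nra.
apply: (ex_series_scal_l (K := R_AbsRing)); exact: ex_series_Rpower.
Qed.

Lemma Re_mult (z w : C) : Re (z * w)%C = Re z * Re w - Im z * Im w.
Proof. by []. Qed.

Lemma cis_ReIm (t : R) : cis t = (cos t, sin t).
Proof. by rewrite /cis /cexp /Re /Im /= exp_0 !Rmult_1_l. Qed.

(** Real part of Lipschitz's formula at psi = 0; the frequency -m gives the pole with v = - (m +
    theta), reflected by evenness of the real part in v. *)
Lemma cos_series_pole (k : nat) (a theta : R) : (1 <= k)%nat -> 0 < a -> 0 < theta < 1 ->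
  exists l,
  is_series (fun d => INR d ^ k * cos (2 * PI * INR d * theta) * exp (- (a * INR d))) (INR (fact k) * l) /\
  is_series (fun m => Re (inv_pole k a (INR m + theta)) + Re (inv_pole k a (INR m + 1 - theta))) l.
Proof.
move=> Hk Ha Ht.
have [l [H1 H2]] := lipschitz k a theta 0 Hk Ha ltac:(lra) ltac:(lra).
exists (Re l); split.
  have H := is_series_scal_l (INR (fact k) : R_AbsRing) _ _ (is_series_Re _ _ H2).
  apply: is_series_ext H => n.
  rewrite Re_mult /cexp /Re /Im /= Rplus_0_r.
  match goal with |- scal ?x ?y = ?z => change (Rmult x y = z) end.
  have -> : 2 * PI * INR n * theta = 2 * PI * theta * INR n by ring.
  field; exact: INR_fact_neq_0.
have H := is_series_Re _ _ H1.
apply: is_series_ext H => m; eqR.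
rewrite !Rmult_0_r cis_0 !Cmult_1_l.
have -> : - INR m - theta = - (INR m + theta) by ring.
by rewrite -(Re_inv_pole_opp k a (INR m + theta) Ha).
Qed.

Lemma sin_2PI_sub (n : nat) (x : R) : sin (2 * PI * INR n * (1 - x)) = - sin (2 * PI * INR n * x).
Proof.
have -> : 2 * PI * INR n * (1 - x) = - (2 * PI * INR n * x) + 2 * INR n * PI by ring.
by rewrite sin_period sin_neg.
Qed.

Lemma cos_2PI_sub (n : nat) (x : R) : cos (2 * PI * INR n * (1 - x)) = cos (2 * PI * INR n * x).
Proof.
have -> : 2 * PI * INR n * (1 - x) = - (2 * PI * INR n * x) + 2 * INR n * PI by ring.
by rewrite cos_period cos_neg.
Qed.

(** The difference of Lipschitz's formulas at psi and 1 - psi, both with theta = 0: the cosine parts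
    cancel and the sine parts add up. *)
Lemma sin_series_pole_Im (k : nat) (z psi : R) : (2 <= k)%nat -> 0 < z -> 0 < psi < 1 ->
  exists l1 l2,
  is_series (fun n => (INR n + psi) ^ k * exp (- (z * (INR n + psi)))) (INR (fact k) * l1) /\
  is_series (fun n => (INR n + 1 - psi) ^ k * exp (- (z * (INR n + 1 - psi)))) (INR (fact k) * l2) /\
  is_series (fun r => sin (2 * PI * INR (S r) * psi) * Im (inv_pole k z (INR (S r)))) (- (l1 - l2) / 4).
Proof.
move=> Hk Hz Hp.
have [l1 [H1 H2]] := lipschitz k z 0 psi ltac:(lia) Hz ltac:(lra) ltac:(lra).
have [l2 [H3 H4]] := lipschitz k z 0 (1 - psi) ltac:(lia) Hz ltac:(lra) ltac:(lra).
exists (Re l1), (Re l2).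
have aux (q : R) l : is_series (V := C_NormedModule) (fun n : nat =>
        (((INR n + q) ^ k / INR (fact k))%R * cexp ((- (z * (INR n + q)))%R, (2 * PI * 0 * (INR n + q))%R))%C) l ->
    is_series (fun n => (INR n + q) ^ k * exp (- (z * (INR n + q)))) (INR (fact k) * Re l).
  move=> H.
  have {}H := is_series_scal_l (INR (fact k) : R_AbsRing) _ _ (is_series_Re _ _ H).
  apply: is_series_ext H => n.
  rewrite Re_mult /cexp /Re /Im /= Rmult_0_r Rmult_0_l cos_0.
  match goal with |- scal ?x ?y = ?z => change (Rmult x y = z) end.
  field; exact: INR_fact_neq_0.
split; [exact: aux | split].
  apply: is_series_ext (aux _ _ H4) => n.
  have -> : INR n + (1 - psi) = INR n + 1 - psi by ring.
  by [].
(* The pair of frequencies -m and m + 1 contributes g m + g (m + 1). As g 0 = 0, the whole sum is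
   twice that of g over r >= 1; together with the factor -2 this explains the divisor -4. *)
pose g m := - 2 * (sin (2 * PI * INR m * psi) * Im (inv_pole k z (INR m))).
have Hgg : is_series (fun m => g m + g (S m)) (Re l1 - Re l2).
  have H := is_series_minus _ _ _ _ (is_series_Re _ _ H1) (is_series_Re _ _ H3).
  apply: is_series_ext H => m.
  match goal with |- plus ?x (opp ?y) = ?z => change (x - y = z) end.
  have Ep (q : R) : Re (cis (2 * PI * - INR m * q) * / pole z (- INR m - 0) ^ S k
     + cis (2 * PI * (INR m + 1) * q) * / pole z (INR m + 1 - 0) ^ S k)%C
     = cos (2 * PI * INR m * q) * Re (inv_pole k z (INR m)) - sin (2 * PI * INR m * q) * Im (inv_pole k z (INR m))
     + (cos (2 * PI * INR (S m) * q) * Re (inv_pole k z (INR (S m))) - sin (2 * PI * INR (S m) * q) * Im (inv_pole k z (INR (S m)))).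
    rewrite !Rminus_0_r -/(inv_pole k z (- INR m)) -/(inv_pole k z (INR m + 1)).
    rewrite re_plus !Re_mult !cis_ReIm Re_inv_pole_opp // Im_inv_pole_opp // -S_INR.
    have -> : 2 * PI * - INR m * q = - (2 * PI * INR m * q) by ring.
    rewrite cos_neg sin_neg [Re (_, _)]/= [Im (_, _)]/=; 
    rewrite [Re (_, _)]/= [Im (_, _)]/=; ring.
  rewrite !Ep !cos_2PI_sub !sin_2PI_sub /g; ring.
(* Splitting the paired series into two copies requires g to be summable on its own. *)
have Hg : ex_series (fun r => g (S r)).
  apply: (ex_series_le _ (fun r => (2 * / z ^ (k - 2) * Rpower z (- (3 / 2))) * Rpower (INR r + 1) (- (3 / 2)))).
    move=> r; rewrite /g.
    match goal with |- norm ?x <= ?y => change (Rabs x <= y) end.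
    have Hr : 0 < INR (S r) by apply: lt_0_INR; lia.
    have Hb := Cmod_inv_pole_le k z (INR (S r)) Hk Hz Hr.
    rewrite -Rpower_mult_distr // in Hb.
    rewrite Rabs_mult (Rabs_mult (sin _) (Im _)) [Rabs (- 2)]Rabs_left; last lra.
    have Hs : Rabs (sin (2 * PI * INR (S r) * psi)) <= 1.
      by apply: Rabs_le; have := SIN_bound (2 * PI * INR (S r) * psi).
    have Hi : Rabs (Im (inv_pole k z (INR (S r)))) <= Cmod (inv_pole k z (INR (S r))).
      exact: Rle_trans (Rmax_r _ _) (Rmax_Cmod _).
    rewrite -S_INR.
    have H0 := Rabs_pos (Im (inv_pole k z (INR (S r)))).
    have H0' := Rabs_pos (sin (2 * PI * INR (S r) * psi)).
    set A := Rabs (sin _) in Hs H0' *; set B := Rabs (Im _) in Hi H0 *.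
    have : A * B <= 1 * B by apply: Rmult_le_compat_r.
    lra.
  apply: (ex_series_scal_l (K := R_AbsRing)); apply: ex_series_Rpower; lra.
have HG := Series_correct _ Hg; set G := Series _ in HG.
have HG0 : is_series g G.
  apply: is_series_decr_1.
  have -> : plus G (opp (g 0%nat)) = G.
    have -> : g 0%nat = 0.
      rewrite /g; have -> : 2 * PI * INR 0 * psi = 0 by rewrite /INR; ring.
      rewrite sin_0; ring.
    change (G + - 0 = G); ring.
  exact: HG.
have E : Re l1 - Re l2 = G + G.
  apply: (is_series_unique_V _ _ _ Hgg); exact: is_series_plus _ _ _ _ HG0 HG.
have -> : - (Re l1 - Re l2) / 4 = (- / 2) * G by rewrite E; field.
apply: is_series_ext (is_series_scal_l ((- / 2) : R_AbsRing) _ _ HG) => r.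
rewrite /g; match goal with |- scal ?x ?y = ?z => change (Rmult x y = z) end; field.
Qed.

(** The factorisation 4 pi^2 v / y + 2 pi i r = (2 pi i / y) (y r - 2 pi i v), raised to the odd
    power k + 1 with i^(k+1) = (-1)^h i. It interchanges the roles of r and v. *)
Lemma Im_inv_pole (k h : nat) (y r v : R) : k = (2 * h)%nat -> 0 < y -> 0 < v -> 0 < r ->
  Im (inv_pole k (4 * PI ^ 2 * v / y) r)
  = - ((-1) ^ h / (2 * PI / y) ^ (k + 1) * Re (inv_pole k (y * r) v)).
Proof.
move=> Hk Hy Hv Hr; have HP := PI_RGT_0.
set q := 2 * PI / y.
have Hq : 0 < q by apply: Rdiv_lt_0_compat; lra.
have Hyr : 0 < y * r by exact: Rmult_lt_0_compat.
have E : pole (4 * PI ^ 2 * v / y) r = (RtoC q * Ci * pole (y * r) (- v))%C.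
  rewrite /pole /Cmult /Ci /RtoC /=; congr pair; rewrite /q; field; lra.
have Hci : (Ci ^ S k = RtoC ((-1) ^ h) * Ci)%C.
  rewrite Hk Cpow_S Cpow_mult_r RtoC_pow Cmult_comm.
  have -> : (Ci ^ 2)%C = RtoC (-1).
    rewrite /Cpow /Cmult /Ci /RtoC /=; congr pair; ring.
  by [].
rewrite {1}/inv_pole E !Cpow_mult_l Hci -RtoC_pow.
have Hqk : q ^ S k <> 0 by apply: pow_nonzero; lra.
have Hh : (-1) ^ h * (-1) ^ h = 1.
  have E1 : -1 * -1 = 1 by ring.
  by rewrite -Rpow_mult_distr E1 pow1.
have Hh0 : (-1) ^ h <> 0 by move=> H; rewrite H in Hh; lra.
have Hp : (pole (y * r) (- v) ^ S k)%C <> 0 by exact: Cpow_nz (pole_neq_0 _ _ Hyr).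
have -> : (/ (RtoC (q ^ S k) * (RtoC ((-1) ^ h) * Ci) * pole (y * r) (- v) ^ S k)
   = RtoC (/ (q ^ S k * (-1) ^ h)) * (- Ci) * inv_pole k (y * r) (- v))%C.
  rewrite RtoC_inv; last exact: Rmult_integral_contrapositive_currified.
  rewrite RtoC_mult /inv_pole -Ci_inv.
  have H1 : RtoC (q ^ S k) <> 0 by move=> /RtoC_inj.
  have H2 : RtoC ((-1) ^ h) <> 0 by move=> /RtoC_inj.
  have H3 : Ci <> 0 by move=> [H]; lra.
  by field.
rewrite inv_pole_opp //.
have -> : / (q ^ S k * (-1) ^ h) = (-1) ^ h / q ^ S k.
  apply: (Rmult_eq_reg_r ((-1) ^ h)) => //.
  have -> : (-1) ^ h / q ^ S k * (-1) ^ h = ((-1) ^ h * (-1) ^ h) / q ^ S k by field.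
  rewrite Hh; field => //.
have -> : (k + 1 = S k)%nat by lia.
rewrite /Cmult /Cconj /Ci /RtoC /Copp /Re /Im [fst (_, _)]/= [snd (_, _)]/=.
rewrite /=; ring.
Qed.

Lemma is_series_Rscal (c : R) (u : nat -> R) (l : R) :
  is_series u l -> is_series (fun n => c * u n) (c * l).
Proof. exact: (is_series_scal_l (K := R_AbsRing) (V := R_NormedModule) c). Qed.

Lemma is_series_Rplus (u v : nat -> R) (a b : R) :
  is_series u a -> is_series v b -> is_series (fun n => u n + v n) (a + b).
Proof. exact: is_series_plus. Qed.

(** For fixed v the poles y r + 2 pi i v are rotated into poles z + 2 pi i r with z = 4 pi^2 v / y,
    to which Lipschitz's formula in the variable r applies. This is where y is replaced by 4 pi^2 /
    y. *)
Lemma sin_series_pole (k h : nat) (y v psi : R) :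
  (2 <= k)%nat -> k = (2 * h)%nat -> 0 < y -> 0 < v -> 0 < psi < 1 ->
  exists p1 p2,
  is_series (fun n => (INR n + psi) ^ k * exp (- (4 * PI ^ 2 / y * ((INR n + psi) * v)))) p1 /\
  is_series (fun n => (INR n + 1 - psi) ^ k * exp (- (4 * PI ^ 2 / y * ((INR n + 1 - psi) * v)))) p2 /\
  is_series (fun r => sin (2 * PI * INR (S r) * psi) * Re (inv_pole k (y * INR (S r)) v))
    ((-1) ^ h * (2 * PI / y) ^ (k + 1) / (4 * INR (fact k)) * (p1 - p2)).
Proof.
move=> Hk Hkh Hy Hv Hp; have HP := PI_RGT_0.
set z := 4 * PI ^ 2 * v / y.
have Hz : 0 < z.
  apply: Rdiv_lt_0_compat => //; apply: Rmult_lt_0_compat => //; nra.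
have [l1 [l2 [H1 [H2 H3]]]] := sin_series_pole_Im k z psi Hk Hz Hp.
exists (INR (fact k) * l1), (INR (fact k) * l2).
have Hzu u : z * u = 4 * PI ^ 2 / y * (u * v) by rewrite /z; field; lra.
split; [|split].
- apply: is_series_ext H1 => n; by rewrite Hzu.
- apply: is_series_ext H2 => n; by rewrite Hzu.
have Hf := INR_fact_neq_0 k.
set q := 2 * PI / y.
have Hq : 0 < q by apply: Rdiv_lt_0_compat; lra.
have Hqk : q ^ (k + 1) <> 0 by apply: pow_nonzero; lra.
have Hh : (-1) ^ h * (-1) ^ h = 1.
  have E1 : -1 * -1 = 1 by ring.
  by rewrite -Rpow_mult_distr E1 pow1.
have -> : (-1) ^ h * q ^ (k + 1) / (4 * INR (fact k)) * (INR (fact k) * l1 - INR (fact k) * l2)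
  = - ((-1) ^ h * q ^ (k + 1)) * (- (l1 - l2) / 4) by field.
apply: is_series_ext (is_series_Rscal (- ((-1) ^ h * q ^ (k + 1))) _ _ H3) => r.
rewrite (Im_inv_pole k h y) //; last by apply: lt_0_INR; lia.
rewrite -/q.
set s := sin _; set w := Re _.
have -> : - ((-1) ^ h * q ^ (k + 1)) * (s * - ((-1) ^ h / q ^ (k + 1) * w))
  = ((-1) ^ h * (-1) ^ h) * (s * w) by field.
by rewrite Hh Rmult_1_l.
Qed.

Lemma Rabs_mult_cos_sin_le (c s t : R) : 0 <= c -> Rabs (c * cos s * sin t) <= c.
Proof.
move=> Hc; rewrite Rabs_mult (Rabs_mult c) (Rabs_pos_eq c) //.
have H1 : Rabs (cos s) <= 1 by apply: Rabs_le; have := COS_bound s.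
have H2 : Rabs (sin t) <= 1 by apply: Rabs_le; have := SIN_bound t.
have H3 := Rabs_pos (cos s); have H4 := Rabs_pos (sin t).
have : Rabs (cos s) * Rabs (sin t) <= 1 * 1 by apply: Rmult_le_compat.
rewrite Rmult_assoc; nra.
Qed.

Definition lambert_coef (k : nat) (theta psi : R) (N : nat) : R :=
  divisor_sum (fun d => INR d ^ k * cos (2 * PI * INR d * theta)
                                  * sin (2 * PI * INR N * psi / INR d)) N.

(* The dual series of the transformation y -> 4 pi^2 / y; w stands for 4 pi^2 / y. *)
Definition dual_term (k : nat) (w u v : R) : R := u ^ k * exp (- (w * (u * v))).

Definition dual_quad (k : nat) (theta psi w : R) (m n : nat) : R :=
  dual_term k w (INR n + psi) (INR m + theta) - dual_term k w (INR n + 1 - psi) (INR m + theta)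
  - dual_term k w (INR n + 1 - psi) (INR m + 1 - theta) + dual_term k w (INR n + psi) (INR m + 1 - theta).

(** One double series over r and m, of sin(2 pi r psi) against the real parts of the poles at m +
    theta and m + 1 - theta, read in two orders: summed over m first it gives the divisor series,
    over r first the dual series. *)
Lemma lambert_transform (k h : nat) (y theta psi : R) :
  (2 <= k)%nat -> k = (2 * h)%nat -> 0 < y -> 0 < theta < 1 -> 0 < psi < 1 ->
  exists (H : nat -> R) (T : R),
  is_series (fun N => exp (- (y * INR (S N))) * lambert_coef k theta psi (S N))
    ((-1) ^ h * (2 * PI / y) ^ (k + 1) / 4 * T) /\
  (forall m, is_series (fun n => dual_quad k theta psi (4 * PI ^ 2 / y) m n) (H m)) /\
  is_series H T.
Proof.
move=> Hk Hkh Hy Ht Hp; have HP := PI_RGT_0.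
have Hf := INR_fact_neq_0 k.
set s := fun r => sin (2 * PI * INR (S r) * psi).
(* The factor produced by the sum over r. It is nonzero, so [T] can be defined by division; its 1 /
   k! cancels the k! of the cosine series. *)
set c0 := (-1) ^ h * (2 * PI / y) ^ (k + 1) / (4 * INR (fact k)).
have Hc0 : c0 <> 0.
  rewrite /c0; apply: Rmult_integral_contrapositive_currified.
    apply: Rmult_integral_contrapositive_currified; apply: pow_nonzero; first lra.
    apply: Rgt_not_eq; apply: Rdiv_lt_0_compat; lra.
  apply: Rinv_neq_0_compat; lra.
have Hyr r : 0 < y * INR (S r) by apply: Rmult_lt_0_compat => //; apply: lt_0_INR; lia.
have cosS r := cos_series_pole k (y * INR (S r)) theta ltac:(lia) (Hyr r) Ht.
have [l Hl] := functional_choice _ cosS => {cosS}.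
have Hm1 m : 0 < INR m + theta by have := pos_INR m; lra.
have Hm2 m : 0 < INR m + 1 - theta by have := pos_INR m; lra.
have S1 m := sin_series_pole k h y (INR m + theta) psi Hk Hkh Hy (Hm1 m) Hp.
have S2 m := sin_series_pole k h y (INR m + 1 - theta) psi Hk Hkh Hy (Hm2 m) Hp.
have [p1 Hp1] := functional_choice _ S1 => {S1}.
have [p2 Hp2] := functional_choice _ Hp1 => {Hp1}.
have [p3 Hp3] := functional_choice _ S2 => {S2}.
have [p4 Hp4] := functional_choice _ Hp3 => {Hp3}.
(* Here [p1], [p2] belong to m + theta and [p3], [p4] to m + 1 - theta; the order is that of the
   four terms of [dual_quad]. *)
pose H m := p1 m - p2 m - p4 m + p3 m.
pose F (d r : nat) := INR d ^ k * cos (2 * PI * INR d * theta) * sin (2 * PI * INR r * psi) * exp (- (y * (INR d * INR r))).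
have [K [HK HKx]] := pow_exp_neg_le k 2 y ltac:(lra) Hy.
have HF1 i j : Rabs (F (S i) (S j)) <= K * Rpower (INR j + 1) (Ropp 2) * Rpower (INR i + 1) (Ropp 2).
  rewrite /F.
  have Hi := pos_INR i; have Hj := pos_INR j.
  rewrite Rabs_mult (Rabs_pos_eq (exp _)); last exact: Rlt_le (exp_pos _).
  have Hx : 0 < INR (S i) * INR (S j) by apply: Rmult_lt_0_compat; apply: lt_0_INR; lia.
  have H1 := HKx _ Hx.
  (* Enlarging d^k to (d r)^k gives a bound in the product d r alone, and a power of d r splits into
     powers of d and of r. *)
  have Hxk : INR (S i) ^ k <= (INR (S i) * INR (S j)) ^ k.
    apply: pow_incr; rewrite !S_INR; split; nra.
  have H2 : Rabs (INR (S i) ^ k * cos (2 * PI * INR (S i) * theta) * sin (2 * PI * INR (S j) * psi)) <= INR (S i) ^ k.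
    apply: Rabs_mult_cos_sin_le; apply: pow_le; exact: pos_INR.
  have He := exp_pos (- (y * (INR (S i) * INR (S j)))).
  apply: (Rle_trans _ ((INR (S i) * INR (S j)) ^ k * exp (- (y * (INR (S i) * INR (S j)))))).
    apply: Rmult_le_compat_r; lra.
  apply: Rle_trans H1 _.
  rewrite -Rpower_mult_distr; try (rewrite S_INR; lra).
  rewrite !S_INR; apply: Req_le; ring.
have HF2 r : is_series (fun i => F (S i) (S r)) (s r * (INR (fact k) * l r)).
  have H1 := proj1 (Hl r).
  have H2 : is_series (fun i => INR (S i) ^ k * cos (2 * PI * INR (S i) * theta) * exp (- (y * INR (S r) * INR (S i)))) (INR (fact k) * l r).
    apply: (is_series_incr_1 (fun i => INR i ^ k * cos (2 * PI * INR i * theta) * exp (- (y * INR (S r) * INR i)))).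
    (* The cosine series starts at d = 0, the divisors at 1; the extra term vanishes since k > 0. *)
    have -> : INR 0 ^ k = 0 by rewrite INR_0 pow_i //; lia.
    rewrite !Rmult_0_l plus_zero_r; exact: H1.
  apply: is_series_ext (is_series_Rscal (s r) _ _ H2) => i; rewrite /F /s.
  have -> : y * (INR (S i) * INR (S r)) = y * INR (S r) * INR (S i) by ring.
  eqR; ring.
have [L [HL1 HL2]] := is_series_divisors F (fun j => K * Rpower (INR j + 1) (Ropp 2))
  (fun i => Rpower (INR i + 1) (Ropp 2)) (fun r => s r * (INR (fact k) * l r))
  ltac:(apply: (ex_series_scal_l (K := R_AbsRing)); apply: (ex_series_Rpower 2); lra)
  ltac:(apply: (ex_series_Rpower 2); lra)
  ltac:(move=> j; apply: Rmult_le_pos; [lra | exact: Rlt_le (Rpower_pos _ _)])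
  ltac:(move=> i; exact: Rlt_le (Rpower_pos _ _))
  HF1 HF2.
have HT : is_series H (L / (INR (fact k) * c0)).
  have HG : is_series (fun r => s r * l r) (/ INR (fact k) * L).
    apply: is_series_ext (is_series_Rscal (/ INR (fact k)) _ _ HL1) => r.
    by eqR; field.
  have HH m : is_series (fun r => s r * (Re (inv_pole k (y * INR (S r)) (INR m + theta)) + Re (inv_pole k (y * INR (S r)) (INR m + 1 - theta)))) (c0 * H m).
    have -> : c0 * H m = c0 * (p1 m - p2 m) + c0 * (p3 m - p4 m) by rewrite /H; ring.
    apply: is_series_ext (is_series_Rplus _ _ _ _ (proj2 (proj2 (Hp2 m))) (proj2 (proj2 (Hp4 m)))) => r.
    by rewrite /s; eqR; ring.
  have HGr r : is_series (fun m => s r * (Re (inv_pole k (y * INR (S r)) (INR m + theta)) + Re (inv_pole k (y * INR (S r)) (INR m + 1 - theta)))) (s r * l r).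
    exact: is_series_Rscal (proj2 (Hl r)).
  have HA0 r : 0 <= / y ^ (k - 2) * Rpower y (- (3 / 2)) * Rpower (INR r + 1) (- (3 / 2)).
    apply: Rmult_le_pos; last exact: Rlt_le (Rpower_pos _ _).
    apply: Rmult_le_pos; last exact: Rlt_le (Rpower_pos _ _).
    apply: Rlt_le; apply: Rinv_0_lt_compat; exact: pow_lt.
  have HB0 m : 0 <= Rpower (INR m + theta) (- (3 / 2)) + Rpower (INR m + (1 - theta)) (- (3 / 2)).
    apply: Rplus_le_le_0_compat; exact: Rlt_le (Rpower_pos _ _).
  have HFb r m : norm (s r * (Re (inv_pole k (y * INR (S r)) (INR m + theta)) + Re (inv_pole k (y * INR (S r)) (INR m + 1 - theta))))
    <= / y ^ (k - 2) * Rpower y (- (3 / 2)) * Rpower (INR r + 1) (- (3 / 2)) * (Rpower (INR m + theta) (- (3 / 2)) + Rpower (INR m + (1 - theta)) (- (3 / 2))).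
    match goal with |- norm ?x <= ?y => change (Rabs x <= y) end.
    have aux v : 0 < v -> Rabs (Re (inv_pole k (y * INR (S r)) v)) <= / y ^ (k - 2) * Rpower y (- (3 / 2)) * Rpower (INR r + 1) (- (3 / 2)) * Rpower v (- (3 / 2)).
      move=> Hv; apply: Rle_trans (re_le_Cmod _) _.
      apply: Rle_trans (Cmod_inv_pole_le k _ v Hk (Hyr r) Hv) _.
      have Hr := pos_INR r.
      have HrS : 0 < INR (S r) by rewrite S_INR; lra.
      have Hyr' := Hyr r.
      rewrite -(Rpower_mult_distr (y * INR (S r)) v) // -(Rpower_mult_distr y (INR (S r))) //.
      rewrite S_INR.
      have -> : / y ^ (k - 2) * Rpower y (- (3 / 2)) * Rpower (INR r + 1) (- (3 / 2)) * Rpower v (- (3 / 2))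
        = / y ^ (k - 2) * (Rpower y (- (3 / 2)) * Rpower (INR r + 1) (- (3 / 2)) * Rpower v (- (3 / 2))) by ring.
      apply: Rmult_le_compat_r.
        apply: Rmult_le_pos; last exact: Rlt_le (Rpower_pos _ _).
        apply: Rmult_le_pos; exact: Rlt_le (Rpower_pos _ _).
      apply: Rinv_le_contravar; first exact: pow_lt.
      apply: pow_incr; nra.
    have B1 := aux _ (Hm1 m); have B2 := aux _ (Hm2 m).
    have -> : INR m + (1 - theta) = INR m + 1 - theta by ring.
    have Hs : Rabs (s r) <= 1 by apply: Rabs_le; have := SIN_bound (2 * PI * INR (S r) * psi).
    rewrite Rabs_mult Rmult_plus_distr_l.
    have B3 := Rabs_triang (Re (inv_pole k (y * INR (S r)) (INR m + theta))) (Re (inv_pole k (y * INR (S r)) (INR m + 1 - theta))).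
    have B4 := Rabs_pos (Re (inv_pole k (y * INR (S r)) (INR m + theta)) + Re (inv_pole k (y * INR (S r)) (INR m + 1 - theta))).
    have B5 := Rabs_pos (s r).
    set X := Rabs (_ + _) in B3 B4 *.
    have : Rabs (s r) * X <= 1 * X by apply: Rmult_le_compat_r.
    lra.
  have Hswap := series_swap (V := R_CompleteNormedModule) _
    (fun r => / y ^ (k - 2) * Rpower y (- (3 / 2)) * Rpower (INR r + 1) (- (3 / 2)))
    (fun m => Rpower (INR m + theta) (- (3 / 2)) + Rpower (INR m + (1 - theta)) (- (3 / 2))) _ _ _
    ltac:(apply: (ex_series_scal_l (K := R_AbsRing)); apply: ex_series_Rpower; lra)
    ltac:(apply: (ex_series_plus (V := R_NormedModule)); apply: ex_series_Rpower_shift; lra)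
    HA0 HB0 HFb HGr HH HG.
  have -> : L / (INR (fact k) * c0) = / c0 * (/ INR (fact k) * L) by field.
  apply: is_series_ext (is_series_Rscal (/ c0) _ _ Hswap) => m; by eqR; field.
exists H, (L / (INR (fact k) * c0)); split; [|split => //].
- have -> : (-1) ^ h * (2 * PI / y) ^ (k + 1) / 4 * (L / (INR (fact k) * c0)) = L.
    have -> : (-1) ^ h * (2 * PI / y) ^ (k + 1) / 4 = c0 * INR (fact k) by rewrite /c0; field; lra.
    by field.
  apply: is_series_ext HL2 => N.
  rewrite /lambert_coef /divisor_sum.
  eqR; apply: (eq_trans _ (sum_n_m_mult_l (K := R_Ring) (exp (- (y * INR (S N)))) _ 1 (S N))).
  apply: sum_n_m_ext_loc => d Hd.
  change mult with Rmult.
  case: (Nat.eqb_spec (S N mod d) 0) => Hdiv; last by eqR; ring.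
  have E : S N = (d * (S N / d))%nat by apply/Nat.Div0.div_exact.
  have HdR : INR d <> 0 by apply: not_0_INR; lia.
  have ER : INR (S N) = INR d * INR (S N / d) by rewrite -mult_INR -E.
  rewrite /F ER; eqR.
  have -> : 2 * PI * (INR d * INR (S N / d)) * psi / INR d = 2 * PI * INR (S N / d) * psi by field.
  ring.
- move=> m; rewrite /H.
  have [A1 [A2 _]] := Hp2 m; have [A3 [A4 _]] := Hp4 m.
  have := is_series_plus _ _ _ _ (is_series_minus _ _ _ _ (is_series_minus _ _ _ _ A1 A2) A4) A3.
  by apply: is_series_ext.
Qed.

(** * Improper integrals of Bessel and Gamma type *)

Notation is_RIntC := (@is_RInt C_R_NormedModule).
Notation RIntC := (@RInt C_R_CompleteNormedModule).

Lemma C_R_norm (x : C) : norm (x : C_R_NormedModule) = Cmod x.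
Proof. exact: (eq_sym (Cmod_norm x)). Qed.

Lemma inv_1_sq_pos (u : R) : 0 < / (1 + u ^ 2).
Proof. apply: Rinv_0_lt_compat; have := pow2_ge_0 u; lra. Qed.

Lemma is_RInt_atan (a b : R) : is_RInt (fun u => / (1 + u ^ 2)) a b (atan b - atan a).
Proof.
apply: (is_RInt_derive atan) => x _.
  apply/is_derive_Reals; exact: derivable_pt_lim_atan.
apply: (ex_derive_continuous (V := R_NormedModule)); auto_derive.
have := pow2_ge_0 x; rewrite /=; lra.
Qed.

Lemma ex_RIntC_continuous (h : R -> C) (a b : R) :
  (forall u, continuous h u) -> is_RIntC h a b (RIntC h a b).
Proof.
move=> H; apply: (RInt_correct (V := C_R_CompleteNormedModule)).
by apply: (ex_RInt_continuous (V := C_R_CompleteNormedModule)) => z _.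
Qed.

Lemma RIntC_Chasles (h : R -> C) (a b c : R) : (forall u, continuous h u) ->
  RIntC h a c = (RIntC h a b + RIntC h b c)%C.
Proof.
move=> H; apply: is_RInt_unique.
exact: is_RInt_Chasles (ex_RIntC_continuous h a b H) (ex_RIntC_continuous h b c H).
Qed.

Lemma RIntC_tail_le (h : R -> C) (K A b b' : R) :
  (forall u, continuous h u) -> 0 <= K -> (forall u, Cmod (h u) <= K * / (1 + u ^ 2)) ->
  0 < A -> A <= b -> b <= b' -> Cmod (RIntC h b b') <= K * / A.
Proof.
move=> Hc HK Hb HA HAb Hbb'.
have HI : is_RInt (fun u => K * / (u ^ 2)) b b' (K * (/ b - / b')).
  have -> : K * (/ b - / b') = minus (- K * / b') (- K * / b) by rewrite /minus /plus /opp /=; ring.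
  apply: (is_RInt_derive (fun u => - K * / u)) => x; rewrite Rmin_left // Rmax_right // => Hx.
    auto_derive; first lra. field; lra.
  apply: (ex_derive_continuous (V := R_NormedModule)); auto_derive.
  rewrite /=; nra.
apply: (Rle_trans _ (K * (/ b - / b'))).
  have Hle u : b <= u <= b' -> norm (h u : C_R_NormedModule) <= K * / u ^ 2.
    move=> Hu; rewrite C_R_norm.
    apply: Rle_trans (Hb u) _; apply: Rmult_le_compat_l => //.
    apply: Rinv_le_contravar; last lra.
    apply: pow_lt; lra.
  rewrite -C_R_norm; exact: (norm_RInt_le (V := C_R_NormedModule) h _ b b' _ _ Hbb' Hle (ex_RIntC_continuous h b b' Hc) HI).
apply: Rmult_le_compat_l => //.
have : / b <= / A by apply: Rinv_le_contravar.
have : 0 < / b' by apply: Rinv_0_lt_compat; lra.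
lra.
Qed.

Lemma ex_half_integral (h : R -> C) (K : R) :
  (forall u, continuous h u) -> (forall u, Cmod (h u) <= K * / (1 + u ^ 2)) ->
  exists l : C, filterlim (fun b => RIntC h 0 b) (Rbar_locally p_infty) (locally l).
Proof.
move=> Hc Hb.
have HK : 0 <= K.
  have := Hb 0; have := Cmod_ge_0 (h 0).
  have -> : 1 + 0 ^ 2 = 1 by ring.
  rewrite Rinv_1; lra.
apply/(filterlim_locally_cauchy (U := C_R_CompleteNormedModule)) => eps.
have He := cond_pos eps.
(* The numerator K + 1 keeps A positive even when K = 0. *)
pose A := (K + 1) / eps.
have HA : 0 < A by apply: Rdiv_lt_0_compat; lra.
have HKA : K * / A < eps.
  have -> : K * / A = eps * (K / (K + 1)) by rewrite /A; field; lra.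
  rewrite -[X in _ < X]Rmult_1_r; apply: Rmult_lt_compat_l => //.
  apply: (Rmult_lt_reg_r (K + 1)); first lra.
  have -> : K / (K + 1) * (K + 1) = K by field; lra.
  lra.
exists (fun b => A < b); split; first by exists A.
have aux u v : A < u -> u <= v -> Cmod (RIntC h 0 v - RIntC h 0 u) < eps.
  move=> Hu Huv.
  rewrite (RIntC_Chasles h 0 u v Hc).
  have -> : (RIntC h 0 u + RIntC h u v - RIntC h 0 u = RIntC h u v)%C by ring.
  apply: Rle_lt_trans HKA; apply: RIntC_tail_le => //; lra.
move=> u v Hu Hv.
case: (Rle_or_lt u v) => Huv.
  apply: (norm_compat1 (V := C_R_NormedModule)); rewrite C_R_norm; exact: (aux u v).
apply: ball_sym; apply: (norm_compat1 (V := C_R_NormedModule)); rewrite C_R_norm; apply: (aux v u) => //; lra.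
Qed.

(* Symmetric intervals are enough: all integrands below are O(1 / (1 + u^2)). *)
Definition is_int (f : R -> C) (l : C) : Prop :=
  exists phi : nat -> C, (forall N, is_RIntC f (- INR N) (INR N) (phi N)) /\ clim phi l.

Lemma is_int_unique (f : R -> C) (l1 l2 : C) : is_int f l1 -> is_int f l2 -> l1 = l2.
Proof.
move=> [p1 [H1 L1]] [p2 [H2 L2]].
apply: (clim_unique p1) => //; apply: clim_ext L2 => N.
have E1 := is_RInt_unique (V := C_R_CompleteNormedModule) _ _ _ _ (H1 N).
have E2 := is_RInt_unique (V := C_R_CompleteNormedModule) _ _ _ _ (H2 N).
by rewrite -E1 -E2.
Qed.

Lemma is_int_ext (f g : R -> C) (l : C) : (forall u, f u = g u) -> is_int f l -> is_int g l.
Proof.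
move=> E [p [H1 L1]]; exists p; split => // N; apply: is_RInt_ext (H1 N) => u _; exact: E.
Qed.

(** The module structure used for these integrals has real scalars, so a complex factor is handled
    through the coordinates. *)
Lemma is_RIntC_scal (c : C) (f : R -> C) (a b : R) (l : C) :
  is_RIntC f a b l -> is_RIntC (fun u => c * f u)%C a b (c * l)%C.
Proof.
move=> H.
have H1 := is_RInt_fct_extend_fst _ _ _ _ H.
have H2 := is_RInt_fct_extend_snd _ _ _ _ H.
apply: (is_RInt_fct_extend_pair (U := R_NormedModule) (V := R_NormedModule)).
- exact: (is_RInt_minus (V := R_NormedModule) _ _ _ _ _ _
    (is_RInt_scal (V := R_NormedModule) _ _ _ (fst c) _ H1) (is_RInt_scal (V := R_NormedModule) _ _ _ (snd c) _ H2)).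
- exact: (is_RInt_plus (V := R_NormedModule) _ _ _ _ _ _
    (is_RInt_scal (V := R_NormedModule) _ _ _ (fst c) _ H2) (is_RInt_scal (V := R_NormedModule) _ _ _ (snd c) _ H1)).
Qed.

Lemma is_int_scal (c : C) (f : R -> C) (l : C) : is_int f l -> is_int (fun u => c * f u)%C (c * l)%C.
Proof.
move=> [p [H1 L1]]; exists (fun N => c * p N)%C; split.
  move=> N; exact: is_RIntC_scal.
apply: clim_mult => //; exact: clim_const.
Qed.

(** On each [-N, N] the M-test gives uniform convergence, hence termwise integration. The limit in N
    is then taken by Tannery's theorem with majorant [M n * PI], because 1 / (1 + u^2) has total
    integral pi. *)
Lemma is_int_series (f : nat -> R -> C) (F : R -> C) (I : nat -> C) (M : nat -> R) :
  (forall n, is_int (f n) (I n)) -> ex_series M -> (forall n, 0 <= M n) ->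
  (forall n u, Cmod (f n u) <= M n * / (1 + u ^ 2)) ->
  (forall u, is_series (V := C_NormedModule) (fun n => f n u) (F u)) ->
  exists J, is_int F J /\ is_series (V := C_NormedModule) I J.
Proof.
move=> Hf HM M0 Hb HF.
have [phi Hphi] := functional_choice _ Hf.
have HbM n u : Cmod (f n u) <= M n.
  apply: Rle_trans (Hb n u) _.
  rewrite -[X in _ <= X]Rmult_1_r; apply: Rmult_le_compat_l => //.
  rewrite -Rinv_1; apply: Rinv_le_contravar; first lra.
  have := pow2_ge_0 u; lra.
have Hunif := sum_n_cvg_unif (V := C_CompleteNormedModule) f M F HM HbM HF.
have Hsum N n : is_RIntC (fun u => sum_n (fun m => f m u) n) (- INR N) (INR N) (sum_n (fun m => phi m N) n).
  elim: n => [|n IH].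
    rewrite sum_O; apply: is_RInt_ext (proj1 (Hphi 0%nat) N) => u _; by rewrite sum_O.
  rewrite Csum_S.
  apply: is_RInt_ext (is_RInt_plus _ _ _ _ _ _ IH (proj1 (Hphi (S n)) N)) => u _.
  by rewrite Csum_S.
have Hpsi N : exists l, is_series (V := C_NormedModule) (fun n => phi n N) l /\ is_RIntC F (- INR N) (INR N) l.
  exact: (filterlim_RInt (V := C_R_CompleteNormedModule) _ (- INR N) (INR N) eventually _ F _ (Hsum N) Hunif).
have [psi Hpsi'] := functional_choice _ Hpsi.
have [J [HJ1 HJ2]] : exists J, is_series (V := C_NormedModule) I J /\ clim psi J.
  apply: (series_dominated (V := C_CompleteNormedModule) phi (fun n => M n * PI)).
  - exact: ex_series_scal_r.
  - move=> n N.
    have HN : - INR N <= INR N by have := pos_INR N; lra.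
    have HI := is_RInt_scal (V := R_NormedModule) _ _ _ (M n) _ (is_RInt_atan (- INR N) (INR N)).
    have Hb' m u : norm (f m u : C_R_NormedModule) <= M m * / (1 + u ^ 2) by rewrite C_R_norm.
    have H := norm_RInt_le (V := C_R_NormedModule) _ _ _ _ _ _ HN (fun u _ => Hb' n u) (proj1 (Hphi n) N) HI.
    normC; rewrite -C_R_norm; apply: Rle_trans H _.
    change (M n * (atan (INR N) - atan (- INR N)) <= M n * PI).
    apply: Rmult_le_compat_l => //.
    have := atan_bound (INR N); have := atan_bound (- INR N); lra.
  - move=> n; exact: (proj2 (Hphi n)).
  - move=> N; exact: (proj1 (Hpsi' N)).
exists J; split => //; exists psi; split => // N; exact: (proj2 (Hpsi' N)).
Qed.

(** * Decay of the integrands *)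

Lemma exp_le (a b : R) : a <= b -> exp a <= exp b.
Proof. case=> [H|->]; [exact: Rlt_le (exp_increasing _ _ H) | exact: Rle_refl]. Qed.

(** From e^(d t) >= (1 + d t / 2)^2 >= 1 + d^2 t^2 / 4; the constant is the one for which (1 + 4 /
    d^2) (1 + d^2 t^2 / 4) >= 1 + t^2. *)
Lemma exp_neg_decay (d : R) : 0 < d ->
  exists K, 0 < K /\ forall t, 0 <= t -> exp (- (d * t)) <= K * / (1 + t ^ 2).
Proof.
move=> Hd; have Hd2 : 0 < 4 / d ^ 2 by apply: Rdiv_lt_0_compat; [lra | exact: pow_lt].
exists (1 + 4 / d ^ 2); split; first lra.
move=> t Ht; rewrite exp_Ropp.
have H1 := exp_ineq1_le (d * t / 2).
have H2 : exp (d * t) = exp (d * t / 2) * exp (d * t / 2) by rewrite -exp_plus; congr exp; field.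
have Hdt : 0 <= d * t by apply: Rmult_le_pos; lra.
have H3 : (1 + d * t / 2) * (1 + d * t / 2) <= exp (d * t) by rewrite H2; apply: Rmult_le_compat; lra.
have Ht2 := pow2_ge_0 t.
apply: (Rmult_le_reg_r (exp (d * t))); first exact: exp_pos.
rewrite Rinv_l; last by apply: Rgt_not_eq; exact: exp_pos.
apply: (Rmult_le_reg_l (1 + t ^ 2)); first lra.
have -> : (1 + t ^ 2) * ((1 + 4 / d ^ 2) * / (1 + t ^ 2) * exp (d * t)) = (1 + 4 / d ^ 2) * exp (d * t) by field; lra.
apply: (Rle_trans _ ((1 + 4 / d ^ 2) * (1 + d ^ 2 * t ^ 2 / 4))).
  have -> : (1 + 4 / d ^ 2) * (1 + d ^ 2 * t ^ 2 / 4) = 1 + t ^ 2 + (4 / d ^ 2 + d ^ 2 * t ^ 2 / 4) by field; lra.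
  have : 0 <= d ^ 2 * t ^ 2 by apply: Rmult_le_pos => //; exact: pow2_ge_0.
  lra.
apply: Rmult_le_compat_l; first lra.
apply: Rle_trans H3; nra.
Qed.

(** The double exponential is below a multiple of e^(-q t) with q = |p| + 1, which absorbs e^(p t)
    and leaves e^(-t). *)
Lemma exp_exp_decay (p c : R) : 0 < c ->
  exists K, 0 < K /\ forall t, 0 <= t -> exp (p * t - c * exp t) <= K * / (1 + t ^ 2).
Proof.
move=> Hc; set q := Rabs p + 1.
have Hq : 0 < q by rewrite /q; have := Rabs_pos p; lra.
have [K [HK H]] := exp_neg_decay 1 ltac:(lra).
exists (Rpower q q * Rpower c (- q) * K); split.
  by apply: Rmult_lt_0_compat => //; apply: Rmult_lt_0_compat; exact: Rpower_pos.
move=> t Ht.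
have He := exp_pos t.
have H1 := exp_neg_le_Rpower q (c * exp t) Hq (Rmult_lt_0_compat _ _ Hc He).
rewrite -Rpower_mult_distr // in H1.
have E : Rpower (exp t) (- q) = exp (- (q * t)) by rewrite /Rpower ln_exp; congr exp; ring.
have -> : p * t - c * exp t = p * t + - (c * exp t) by ring.
rewrite exp_plus.
apply: (Rle_trans _ (exp (p * t) * (Rpower q q * (Rpower c (- q) * Rpower (exp t) (- q))))).
  apply: Rmult_le_compat_l => //; exact: Rlt_le (exp_pos _).
have -> : exp (p * t) * (Rpower q q * (Rpower c (- q) * Rpower (exp t) (- q)))
   = Rpower q q * Rpower c (- q) * (exp (p * t) * Rpower (exp t) (- q)) by ring.
rewrite [X in _ <= X]Rmult_assoc; apply: Rmult_le_compat_l.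
  by apply: Rlt_le; apply: Rmult_lt_0_compat; exact: Rpower_pos.
rewrite E -exp_plus.
apply: Rle_trans (H t Ht); apply: exp_le.
have := Rle_abs p; rewrite /q; nra.
Qed.

(** On the right the double exponential decides; on the left only e^(s t) is small, whence s > 0. *)
Lemma gamma_decay (s : R) : 0 < s ->
  exists K, 0 < K /\ forall t, exp (s * t - exp t) <= K * / (1 + t ^ 2).
Proof.
move=> Hs.
have [K1 [HK1 H1]] := exp_exp_decay s 1 ltac:(lra).
have [K2 [HK2 H2]] := exp_neg_decay s Hs.
exists (K1 + K2); split; first lra.
move=> t; have Hw := inv_1_sq_pos t.
case: (Rle_or_lt 0 t) => Ht.
  have := H1 t Ht; rewrite Rmult_1_l; nra.
have H := H2 (- t) ltac:(lra).
have E : (- t) ^ 2 = t ^ 2 by ring.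
rewrite E in H.
apply: (Rle_trans _ (exp (- (s * - t)))).
  apply: exp_le; have := exp_pos t; lra.
nra.
Qed.

(** A double exponential acts at each end, so the sign of [s] is free. *)
Lemma bessel_decay (s c : R) : 0 < c ->
  exists K, 0 < K /\ forall t, exp (s * t - c * (exp t + exp (- t))) <= K * / (1 + t ^ 2).
Proof.
move=> Hc.
have [K1 [HK1 H1]] := exp_exp_decay s c Hc.
have [K2 [HK2 H2]] := exp_exp_decay (- s) c Hc.
exists (K1 + K2); split; first lra.
move=> t; have Hw := inv_1_sq_pos t.
have He1 := exp_pos t; have He2 := exp_pos (- t).
case: (Rle_or_lt 0 t) => Ht.
  have H := H1 t Ht.
  apply: (Rle_trans _ (exp (s * t - c * exp t))); first by apply: exp_le; nra.
  nra.
have H := H2 (- t) ltac:(lra).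
have E : (- t) ^ 2 = t ^ 2 by ring.
rewrite E in H.
apply: (Rle_trans _ (exp (- s * - t - c * exp (- t)))); first by apply: exp_le; nra.
nra.
Qed.

Lemma continuous_cexp_mult (s : C) (g : R -> R) (u : R) :
  continuous g u -> continuous (fun u : R => cexp (s * RtoC u) * RtoC (g u))%C u.
Proof.
move=> Hg.
apply: (filterlim_ext (fun u => (exp (Re s * u) * cos (Im s * u) * g u, exp (Re s * u) * sin (Im s * u) * g u))).
  move=> v; case: s => a b; rewrite /cexp /Cmult /RtoC /Re /Im /= !Rmult_0_r !Rminus_0_r Rplus_0_l.
  congr pair; ring.
have E : (cexp (s * RtoC u) * RtoC (g u))%C = (exp (Re s * u) * cos (Im s * u) * g u, exp (Re s * u) * sin (Im s * u) * g u).
  case: s => a b; rewrite /cexp /Cmult /RtoC /Re /Im /= !Rmult_0_r !Rminus_0_r Rplus_0_l.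
  congr pair; ring.
rewrite E.
apply: filterlim_C_pair; apply: (continuous_mult (K := R_AbsRing)) => //;
  apply: (ex_derive_continuous (V := R_NormedModule)); by auto_derive.
Qed.

Lemma Cmod_cexp_mult (s : C) (u r : R) : 0 <= r ->
  Cmod (cexp (s * RtoC u) * RtoC r) = exp (Re s * u) * r.
Proof.
move=> Hr; rewrite Cmod_mult Cmod_RtoC_pos // Cmod_cexp; congr (exp _ * _).
case: s => a b; rewrite /Re /Cmult /RtoC /=; ring.
Qed.

(** * Bessel and Gamma integrals over the line *)

Lemma RIntC_opp (h : R -> C) (b : R) : (forall u, continuous h u) ->
  RIntC h (- b) 0 = RIntC (fun t => h (- t)) 0 b.
Proof.
move=> Hc; apply: eq_sym; apply: (is_RInt_unique (V := C_R_CompleteNormedModule)).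
have H := ex_RIntC_continuous h (- 0) (- b) Hc.
have H1 := is_RInt_opp _ _ _ _ (is_RInt_comp_opp _ _ _ _ H).
have -> : RIntC h (- b) 0 = opp (RIntC h (- 0) (- b)).
  rewrite Ropp_0; apply: (is_RInt_unique (V := C_R_CompleteNormedModule)).
  apply: is_RInt_swap; exact: ex_RIntC_continuous.
apply: is_RInt_ext H1 => t _; exact: opp_opp.
Qed.

Lemma filterlim_INR_shift (s : R) : filterlim (fun N => INR N + s) eventually (Rbar_locally p_infty).
Proof.
move=> P [A HA]; have [n Hn] := nfloor_ex (Rmax 0 (A - s)) (Rmax_l _ _).
exists (S n) => m Hm; apply: HA.
have H1 := le_INR _ _ Hm; rewrite S_INR in H1.
have := Rmax_r 0 (A - s); lra.
Qed.

(** A translation moves [-N, N] to an interval that is no longer symmetric, so separate limits on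
    the two half-lines are assumed. *)
Lemma is_int_shift (h : R -> C) (l1 l2 : C) (s : R) : (forall u, continuous h u) ->
  filterlim (fun b => RIntC h 0 b) (Rbar_locally p_infty) (locally l1) ->
  filterlim (fun b => RIntC (fun t => h (- t)) 0 b) (Rbar_locally p_infty) (locally l2) ->
  is_int (fun u => h (u + s)) (l1 + l2)%C.
Proof.
move=> Hc H1 H2.
exists (fun N => RIntC h (- INR N + s) (INR N + s)); split.
  move=> N.
  have H := is_RInt_comp_lin (V := C_R_NormedModule) h 1 s (- INR N) (INR N) (RIntC h (- INR N + s) (INR N + s)).
  rewrite !Rmult_1_l in H.
  apply: is_RInt_ext (H (ex_RIntC_continuous _ _ _ Hc)) => u _.
  by rewrite scal_one Rmult_1_l.
apply: (clim_ext (fun N => Cplus (RIntC h 0 (INR N + s)) (RIntC (fun t => h (- t)) 0 (INR N + - s)))).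

  move=> N; rewrite (RIntC_Chasles h (- INR N + s) 0 (INR N + s) Hc) Cplus_comm; congr (_ + _)%C.
  rewrite -RIntC_opp //; congr (RIntC h _ 0); ring.
apply: clim_plus.
  exact: filterlim_comp (filterlim_INR_shift s) H1.
exact: filterlim_comp (filterlim_INR_shift (- s)) H2.
Qed.

Lemma continuous_C_opp (h : R -> C) (u : R) : (forall u, continuous h u) -> continuous (fun t => h (- t)) u.
Proof.
move=> H; apply: (continuous_comp Ropp h); last exact: H.
apply: (ex_derive_continuous (V := R_NormedModule)); by auto_derive.
Qed.

Lemma ex_two_sided (h : R -> C) (K : R) : (forall u, continuous h u) ->
  (forall u, Cmod (h u) <= K * / (1 + u ^ 2)) ->
  exists l1 l2 : C,
  filterlim (fun b => RIntC h 0 b) (Rbar_locally p_infty) (locally l1) /\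
  filterlim (fun b => RIntC (fun t => h (- t)) 0 b) (Rbar_locally p_infty) (locally l2).
Proof.
move=> Hc Hb.
have [l1 H1] := ex_half_integral h K Hc Hb.
have [l2 H2] : exists l2 : C, filterlim (fun b => RIntC (fun t => h (- t)) 0 b) (Rbar_locally p_infty) (locally l2).
  apply: (ex_half_integral _ K).
    move=> u; exact: continuous_C_opp.
  move=> u; have := Hb (- u); have -> : (- u) ^ 2 = u ^ 2 by ring.
  by [].
by exists l1, l2.
Qed.

(** The translation u = t + (ln Y) / 2 balances the two exponentials into sqrt Y (e^t + e^(-t)) and
    releases the factor Y^(nu/2). Folding t onto -t then gives the integral of cosh (nu t) that
    defines [BesselK], with a factor 2. *)
Lemma is_int_bessel (nu : C) (Y : R) : 0 < Y ->
  is_int (fun u => cexp (nu * RtoC u) * RtoC (exp (- (exp u + Y * exp (- u)))))%C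
    (RtoC 2 * cpowR Y (nu / RtoC 2) * BesselK nu (2 * sqrt Y))%C.
Proof.
move=> HY; set q := sqrt Y; have Hq : 0 < q by exact: sqrt_lt_R0.
have Hqq : q * q = Y by apply: sqrt_sqrt; lra.
pose h (u : R) := (cexp (nu * RtoC u) * RtoC (exp (- (q * (exp u + exp (- u))))))%C.
have Hc u : continuous h u.
  apply: continuous_cexp_mult; apply: (ex_derive_continuous (V := R_NormedModule)); by auto_derive.
have [K [HK HKb]] := bessel_decay (Re nu) q Hq.
have Hb u : Cmod (h u) <= K * / (1 + u ^ 2).
  rewrite Cmod_cexp_mult -?exp_plus; last exact: Rlt_le (exp_pos _).
  exact: HKb.
have [l1 [l2 [H1 H2]]] := ex_two_sided h K Hc Hb.
have Hgen : is_RInt_gen (V := C_R_NormedModule)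
    (fun t => Cmult (RtoC (exp (- (2 * q) * cosh t))) (ccosh (Cmult nu (RtoC t))))
    (at_point 0) (Rbar_locally p_infty) (/ RtoC 2 * (l1 + l2))%C.
  have Hlim : filterlim (fun b => / RtoC 2 * (RIntC h 0 b + RIntC (fun t => h (- t)%R) 0 b))%C (Rbar_locally p_infty)
      (locally (/ RtoC 2 * (l1 + l2) : C)%C).
    have HR (F : (R -> Prop) -> Prop) (FF : Filter F) (u v : R -> C) (a b : C) :
      filterlim u F (locally a) -> filterlim v F (locally b) ->
      filterlim (fun t => / RtoC 2 * (u t + v t))%C F (locally (/ RtoC 2 * (a + b) : C)%C).
      move=> Hu Hv.
      have P : filterlim (fun t => plus (u t : C_NormedModule) (v t)) F (locally (plus (a : C_NormedModule) b)).
        apply: filterlim_comp_2 Hu Hv _; exact: (filterlim_plus (V := C_NormedModule)).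
      apply: filterlim_comp P _; exact: (filterlim_scal_r (K := C_AbsRing) (V := C_NormedModule) (/ RtoC 2)%C).
    exact: HR.
  move=> P HP.
  apply: (Filter_prod _ _ _ (fun a => a = 0) (fun b => P (/ RtoC 2 * (RIntC h 0 b + RIntC (fun t => h (- t)%R) 0 b))%C)).
  - by [].
  - exact: Hlim.
  - move=> a b -> HPb; exists (/ RtoC 2 * (RIntC h 0 b + RIntC (fun t => h (- t)%R) 0 b))%C; split => //.
    have I1 := ex_RIntC_continuous h 0 b Hc.
    have I2 := ex_RIntC_continuous (fun t => h (- t)) 0 b (fun u => continuous_C_opp h u Hc).
    apply: is_RInt_ext (is_RIntC_scal (/ RtoC 2)%C _ _ _ _ (is_RInt_plus _ _ _ _ _ _ I1 I2)) => t _.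
    change plus with Cplus; eqC; rewrite /h Ropp_involutive /ccosh.
    have E1 : - (q * (exp t + exp (- t))) = - (2 * q) * cosh t by rewrite /cosh; field.
    have E2 : - (q * (exp (- t) + exp t)) = - (2 * q) * cosh t by rewrite /cosh; field.
    have E3 : (nu * RtoC (- t) = - (nu * RtoC t))%C by rewrite RtoC_opp; ring.
    rewrite E1 E2 E3 /Cdiv; ring.
have HB : BesselK nu (2 * q) = (/ RtoC 2 * (l1 + l2))%C.
  exact: (is_RInt_gen_unique (V := C_R_CompleteNormedModule) (Fa := at_point 0) (Fb := Rbar_locally p_infty) _ _ Hgen).
have Hfin := is_int_scal (cpowR Y (nu / RtoC 2)) _ _ (is_int_shift h l1 l2 (- (ln Y / 2)) Hc H1 H2).
have -> : (RtoC 2 * cpowR Y (nu / RtoC 2) * BesselK nu (2 * q) = cpowR Y (nu / RtoC 2) * (l1 + l2))%C.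
  rewrite HB; field; by move=> /RtoC_inj; lra.
apply: is_int_ext Hfin => u.
rewrite /h /cpowR Cmult_assoc -cexp_plus; congr (cexp _ * RtoC (exp _))%C.
  rewrite RtoC_plus RtoC_opp RtoC_div; last lra.
  field; by move=> /RtoC_inj; lra.
have Eq : exp (ln Y / 2) = q.
  rewrite /q -(Rpower_sqrt Y) // /Rpower; congr exp; field.
have -> : - (u + - (ln Y / 2)) = - u + ln Y / 2 by ring.
rewrite !exp_plus exp_Ropp Eq -Hqq.
have Hq0 : q <> 0 by lra.
by field.
Qed.

(** Substitution t = e^u, for which t^(s-1) dt = e^(s u) du. *)
Lemma is_RInt_gamma_log (s : C) (h : R -> C) (a b : R) :
  (forall u, h u = cexp (s * RtoC u) * RtoC (exp (- exp u)))%C ->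
  (forall u, continuous h u) -> 0 < a -> 0 < b ->
  is_RIntC (fun t => Cmult (cpowR t (Cminus s (RtoC 1))) (RtoC (exp (- t)))) a b (RIntC h (ln a) (ln b)).
Proof.
move=> Hh Hc Ha Hb.
have Hmin : 0 < Rmin a b by apply: Rmin_pos.
have H := is_RInt_comp (V := C_R_CompleteNormedModule) h ln Rinv a b (fun x _ => Hc (ln x)).
have H0 : forall x, Rmin a b <= x <= Rmax a b -> is_derive ln x (/ x) /\ continuous Rinv x.
  move=> x Hx; have Hx0 : 0 < x by lra.
  split; first exact: is_derive_ln.
  apply: (ex_derive_continuous (V := R_NormedModule)); auto_derive; lra.
apply: is_RInt_ext (H H0) => t Ht.
have Ht0 : 0 < t by lra.
eqC; rewrite Hh exp_ln // /cpowR.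
have -> : ((s - RtoC 1) * RtoC (ln t) = s * RtoC (ln t) + RtoC (- ln t))%C by rewrite RtoC_opp; ring.
rewrite cexp_plus.
have -> : cexp (RtoC (- ln t)) = RtoC (/ t).
  rewrite /cexp /RtoC /Re /Im /= cos_0 sin_0 exp_Ropp exp_ln //; congr pair; ring.
set z := cexp _; set e := exp _.
have E : forall w : C, scal (/ t) w = (RtoC (/ t) * w)%C.
  move=> [w1 w2]; rewrite /scal /= /prod_scal /scal /= /mult /= /Cmult /RtoC /=; congr pair; ring.
rewrite E; ring.
Qed.

(** The logarithm carries the end 0 of the Gamma integral to -oo; translating u by ln B then inserts
    B and divides by B^s. *)
Lemma is_int_gamma (s : C) (B : R) : 0 < Re s -> 0 < B ->
  is_int (fun u => cexp (s * RtoC u) * RtoC (exp (- (B * exp u))))%C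
    (CGamma s / cpowR B s)%C.
Proof.
move=> Hs HB.
pose h (u : R) := (cexp (s * RtoC u) * RtoC (exp (- exp u)))%C.
have Hc u : continuous h u.
  apply: continuous_cexp_mult; apply: (ex_derive_continuous (V := R_NormedModule)); by auto_derive.
have [K [HK HKb]] := gamma_decay (Re s) Hs.
have Hb u : Cmod (h u) <= K * / (1 + u ^ 2).
  rewrite Cmod_cexp_mult -?exp_plus; last exact: Rlt_le (exp_pos _).
  exact: HKb.
have [l1 [l2 [H1 H2]]] := ex_two_sided h K Hc Hb.
have Hgen : is_RInt_gen (V := C_R_NormedModule)
    (fun t => Cmult (cpowR t (Cminus s (RtoC 1))) (RtoC (exp (- t))))
    (at_right 0) (Rbar_locally p_infty) (l2 + l1)%C.
  have L1 : filterlim (fun b => RIntC h 0 (ln b)) (Rbar_locally p_infty) (locally l1).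
    exact: filterlim_comp is_lim_ln_p H1.
  have L2 : filterlim (fun a => RIntC (fun t => h (- t)) 0 (- ln a)) (at_right 0) (locally l2).
    apply: (filterlim_comp _ _ _ (fun a => - ln a) (fun b => RIntC (fun t => h (- t)) 0 b) _ (Rbar_locally p_infty) _ _ H2).
    exact: (filterlim_comp _ _ _ ln Ropp _ (Rbar_locally m_infty) _ is_lim_ln_0 (filterlim_Rbar_opp m_infty)).
  have L : filterlim (fun ab => plus (RIntC (fun t => h (- t)) 0 (- ln (fst ab)) : C_NormedModule) (RIntC h 0 (ln (snd ab))))
      (filter_prod (at_right 0) (Rbar_locally p_infty)) (locally (plus (l2 : C_NormedModule) l1)).
    have L2' : filterlim (fun ab : R * R => RIntC (fun t => h (- t)) 0 (- ln (fst ab))) (filter_prod (at_right 0) (Rbar_locally p_infty)) (locally l2).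
      exact: filterlim_comp filterlim_fst L2.
    have L1' : filterlim (fun ab : R * R => RIntC h 0 (ln (snd ab))) (filter_prod (at_right 0) (Rbar_locally p_infty)) (locally l1).
      exact: filterlim_comp filterlim_snd L1.
    apply: filterlim_comp_2 L2' L1' _; exact: (filterlim_plus (V := C_NormedModule)).
  move=> P HP; have HE := L P HP.
  have Hpos : filter_prod (at_right 0) (Rbar_locally p_infty) (fun ab : R * R => 0 < fst ab /\ 0 < snd ab).
    apply: (Filter_prod _ _ _ (fun a => 0 < a) (fun b => 0 < b)) => //.
    - by exists (mkposreal 1 Rlt_0_1) => y _.
    - by exists 0.
  have FP : Filter (filter_prod (at_right 0) (Rbar_locally p_infty)) by typeclasses eauto.
  refine (@filter_imp _ _ FP _ _ _ (@filter_and _ _ FP _ _ HE Hpos)) => -[a b] /= [HPab [Ha0 Hb0]].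
  exists (RIntC h (ln a) (ln b)); split; first exact: is_RInt_gamma_log.
  suff -> : RIntC h (ln a) (ln b) = plus (RIntC (fun t => h (- t)) 0 (- ln a) : C_NormedModule) (RIntC h 0 (ln b)) by exact: HPab.
  rewrite (RIntC_Chasles h _ 0 _ Hc) -RIntC_opp // Ropp_involutive //.
have HG : CGamma s = (l2 + l1)%C.
  exact: (is_RInt_gen_unique (V := C_R_CompleteNormedModule) (Fa := at_right 0) (Fb := Rbar_locally p_infty) _ _ Hgen).
have Hfin := is_int_scal (/ cpowR B s)%C _ _ (is_int_shift h l1 l2 (ln B) Hc H1 H2).
have -> : (CGamma s / cpowR B s = / cpowR B s * (l1 + l2))%C by rewrite HG /Cdiv; ring.
apply: is_int_ext Hfin => u.
rewrite /h /cpowR -cexp_opp Cmult_assoc -cexp_plus; congr (cexp _ * RtoC (exp _))%C.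
  rewrite RtoC_plus; ring.
rewrite exp_plus exp_ln //; ring.
Qed.

(** * Summation *)

Definition quad (t : R -> R -> C) (theta psi : R) (m n : nat) : C :=
  Cplus (Cminus (Cminus (t (INR n + psi) (INR m + theta))
                        (t (INR n + 1 - psi) (INR m + theta)))
                (t (INR n + 1 - psi) (INR m + 1 - theta)))
        (t (INR n + psi) (INR m + 1 - theta)).

(** Covers the shifts n + c and n + 1 - c together, so that a single product of weights dominates
    all four terms of [quad]. *)
Definition shift_weight (c p : R) (n : nat) : R :=
  Rpower (INR n + c) (- p) + Rpower (INR n + (1 - c)) (- p).

Lemma shift_weight_pos (c p : R) (n : nat) : 0 < shift_weight c p n.
Proof.
have := Rpower_pos (INR n + c) (- p); have := Rpower_pos (INR n + (1 - c)) (- p).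
rewrite /shift_weight; lra.
Qed.

Lemma ex_series_shift_weight (c p : R) : 1 < p -> 0 < c < 1 -> ex_series (shift_weight c p).
Proof.
move=> Hp Hc; apply: (ex_series_plus (V := R_NormedModule)); apply: ex_series_Rpower_shift; lra.
Qed.

Lemma Cmod_quad_le (t : R -> R -> C) (K p q theta psi : R) :
  (forall u v, 0 < u -> 0 < v -> Cmod (t u v) <= K * Rpower u (- q) * Rpower v (- p)) ->
  0 < theta < 1 -> 0 < psi < 1 ->
  forall m n, Cmod (quad t theta psi m n) <= K * shift_weight theta p m * shift_weight psi q n.
Proof.
move=> Ht Hth Hps m n; have Hm := pos_INR m; have Hn := pos_INR n.
rewrite /quad /shift_weight.
have -> : INR n + (1 - psi) = INR n + 1 - psi by ring.
have -> : INR m + (1 - theta) = INR m + 1 - theta by ring.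
have B1 := Ht (INR n + psi) (INR m + theta) ltac:(lra) ltac:(lra).
have B2 := Ht (INR n + 1 - psi) (INR m + theta) ltac:(lra) ltac:(lra).
have B3 := Ht (INR n + 1 - psi) (INR m + 1 - theta) ltac:(lra) ltac:(lra).
have B4 := Ht (INR n + psi) (INR m + 1 - theta) ltac:(lra) ltac:(lra).
set z1 := t _ _ in B1 *; set z2 := t _ _ in B2 *; set z3 := t _ _ in B3 *; set z4 := t _ _ in B4 *.
have T1 := Cmod_triangle (z1 - z2 - z3) z4.
have T2 := Cmod_triangle (z1 - z2) (- z3).
have T3 := Cmod_triangle z1 (- z2).
rewrite !Cmod_opp in T2 T3.
rewrite /Cminus in T1 T2 T3 *.
lra.
Qed.

Lemma is_int_plus (f g : R -> C) (a b : C) :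
  is_int f a -> is_int g b -> is_int (fun u => f u + g u)%C (a + b)%C.
Proof.
move=> [p [H1 L1]] [r [H2 L2]]; exists (fun N => p N + r N)%C; split.
  move=> N; exact: (is_RInt_plus (V := C_R_NormedModule) _ _ _ _ _ _ (H1 N) (H2 N)).
exact: clim_plus.
Qed.

Lemma is_int_minus (f g : R -> C) (a b : C) :
  is_int f a -> is_int g b -> is_int (fun u => f u - g u)%C (a - b)%C.
Proof.
move=> Hf Hg.
have H := is_int_plus _ _ _ _ Hf (is_int_scal (- RtoC 1)%C _ _ Hg).
have -> : (a - b = a + - RtoC 1 * b)%C by ring.
apply: is_int_ext H => u; ring.
Qed.

Lemma is_int_quad (t : R -> R -> R -> C) (l : R -> R -> C) (theta psi : R) :
  (forall v w, 0 < v -> 0 < w -> is_int (fun u => t u v w) (l v w)) ->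
  0 < theta < 1 -> 0 < psi < 1 ->
  forall m n, is_int (fun u => quad (t u) theta psi m n) (quad l theta psi m n).
Proof.
move=> Ht Hth Hps m n; have Hm := pos_INR m; have Hn := pos_INR n.
apply: is_int_plus; last by apply: Ht; lra.
apply: is_int_minus; last by apply: Ht; lra.
apply: is_int_minus; by apply: Ht; lra.
Qed.

Lemma lambert_coef_le (k : nat) (theta psi : R) (N : nat) : (0 < N)%nat ->
  Rabs (lambert_coef k theta psi N) <= INR N ^ (k + 1).
Proof.
move=> HN; rewrite /lambert_coef /divisor_sum.
apply: Rle_trans (norm_sum_n_m (V := R_NormedModule) _ _ _) _.
(* The comparison of sums asks for a bound at every index, so the terms beyond [N] are replaced by
   0. *)
rewrite (sum_n_m_ext_loc _ (fun d => if Nat.leb d N then Rabs (if Nat.eqb (N mod d) 0 then INR d ^ k * cos (2 * PI * INR d * theta) * sin (2 * PI * INR N * psi / INR d) else 0) else 0)); last first.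
  move=> d Hd; case: Nat.leb_spec => //; lia.
apply: Rle_trans (sum_n_m_le _ (fun _ => INR N ^ k) _ _ _) _.
  move=> d; have HNk : 0 <= INR N ^ k by apply: pow_le; exact: pos_INR.
  case: Nat.leb_spec => // Hd.
  case: Nat.eqb; last by rewrite Rabs_R0.
  apply: Rle_trans (Rabs_mult_cos_sin_le _ _ _ (pow_le _ _ (pos_INR d))) _.
  apply: pow_incr; split; [exact: pos_INR | exact: le_INR].
rewrite sum_n_m_const pow_add pow_1.
have -> : (S N - 1 = N)%nat by lia.
rewrite Rmult_comm; exact: Rle_refl.
Qed.

(** * Majorants for exchanging sum and integral *)

Lemma Rpower_exp (u p : R) : Rpower (exp u) p = exp (p * u).
Proof. by rewrite /Rpower ln_exp. Qed.

(** With p = k + 1 + sigma/2, exp(- w U V e^u) is O((U V)^(-p) e^(-p u)). The factor U^k leaves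
    U^(-1-sigma/2), and what remains in u is e^(sigma u/2 - e^u), covered by [gamma_decay]. *)
Lemma dual_integrand_bound (k : nat) (sigma w : R) : 0 < sigma -> 0 < w ->
  exists K, 0 <= K /\ forall u U V, 0 < U -> 0 < V ->
  U ^ k * (exp ((sigma + INR k + 1) * u) * exp (- ((w * (U * V) + 1) * exp u)))
  <= K * / (1 + u ^ 2) * Rpower U (- (1 + sigma / 2)) * Rpower V (- (INR k + 1 + sigma / 2)).
Proof.
move=> Hs Hw; set p := INR k + 1 + sigma / 2; have Hk := pos_INR k.
have Hp : 0 < p by rewrite /p; lra.
have [Kg [HKg Hg]] := gamma_decay (sigma / 2) ltac:(lra).
exists (Rpower p p * Rpower w (- p) * Kg); split.
  apply: Rmult_le_pos; last lra.
  by apply: Rmult_le_pos; exact: Rlt_le (Rpower_pos _ _).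
move=> u U V HU HV; have He := exp_pos u.
have HUV : 0 < U * V by exact: Rmult_lt_0_compat.
have HwUV : 0 < w * (U * V) by exact: Rmult_lt_0_compat.
have H := exp_neg_le_Rpower p (w * (U * V) * exp u) Hp (Rmult_lt_0_compat _ _ HwUV He).
rewrite -(Rpower_mult_distr (w * (U * V))) // -(Rpower_mult_distr w) // -(Rpower_mult_distr U) // Rpower_exp in H.
have -> : - ((w * (U * V) + 1) * exp u) = - (w * (U * V) * exp u) + - exp u by ring.
rewrite exp_plus.
have HUk : 0 < U ^ k by exact: pow_lt.
have E1 : Rpower U (- (1 + sigma / 2)) = U ^ k * Rpower U (- p).
  rewrite -(Rpower_pow k) // -Rpower_plus; congr Rpower; rewrite /p; ring.
have E2 : exp (sigma / 2 * u - exp u) = exp ((sigma + INR k + 1) * u) * exp (- exp u) * exp (- p * u).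
  rewrite -!exp_plus; congr exp; rewrite /p; field.
have Hgu := Hg u; rewrite E2 in Hgu.
set A := exp ((sigma + INR k + 1) * u) * exp (- exp u) in Hgu.
have HA : 0 < A by apply: Rmult_lt_0_compat; exact: exp_pos.
have -> : U ^ k * (exp ((sigma + INR k + 1) * u) * (exp (- (w * (U * V) * exp u)) * exp (- exp u)))
  = (U ^ k * A) * exp (- (w * (U * V) * exp u)) by rewrite /A; ring.
apply: (Rle_trans _ ((U ^ k * A) * (Rpower p p * (Rpower w (- p) * (Rpower U (- p) * Rpower V (- p)) * exp (- p * u))))).
  apply: Rmult_le_compat_l => //; apply: Rmult_le_pos; lra.
rewrite E1.
set W := Rpower p p * Rpower w (- p) * (U ^ k * Rpower U (- p)) * Rpower V (- p).
have HW : 0 <= W.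
  rewrite /W; have HR x := Rlt_le _ _ (Rpower_pos x (- p)).
  apply: Rmult_le_pos => //; apply: Rmult_le_pos; apply: Rmult_le_pos => //; [exact: Rlt_le (Rpower_pos _ _) | lra].
have -> : U ^ k * A * (Rpower p p * (Rpower w (- p) * (Rpower U (- p) * Rpower V (- p)) * exp (- p * u)))
  = W * (A * exp (- p * u)) by rewrite /W; ring.
have -> : Rpower p p * Rpower w (- p) * Kg * / (1 + u ^ 2) * (U ^ k * Rpower U (- p)) * Rpower V (- p)
  = W * (Kg * / (1 + u ^ 2)) by rewrite /W; ring.
exact: Rmult_le_compat_l.
Qed.

Lemma Cmod_cpowR (b : R) (s : C) : Cmod (cpowR b s) = Rpower b (Re s).
Proof.
rewrite /cpowR Cmod_cexp /Rpower; congr exp.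
case: s => p q; rewrite /Re /Cmult /RtoC /=; ring.
Qed.

(** The same exponents as for the integrand: (w U V + 1)^(-Re s) <= (w U V)^(-p), because p <= Re
    s. *)
Lemma dual_value_bound (k : nat) (w : R) (s : C) (sigma : R) : 0 < sigma -> 0 < w ->
  Re s = sigma + INR k + 1 ->
  exists K, 0 <= K /\ forall U V, 0 < U -> 0 < V ->
  Cmod (RtoC (U ^ k) / cpowR (w * (U * V) + 1) s)
  <= K * Rpower U (- (1 + sigma / 2)) * Rpower V (- (INR k + 1 + sigma / 2)).
Proof.
move=> Hs Hw Hre; set p := INR k + 1 + sigma / 2; have Hk := pos_INR k.
have Hp : 0 < p by rewrite /p; lra.
exists (Rpower w (- p)); split; first exact: Rlt_le (Rpower_pos _ _).
move=> U V HU HV.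
have HUV : 0 < U * V by exact: Rmult_lt_0_compat.
have HwUV : 0 < w * (U * V) by exact: Rmult_lt_0_compat.
have HUk : 0 < U ^ k by exact: pow_lt.
rewrite Cmod_div; last exact: cexp_neq_0.
rewrite Cmod_cpowR Hre Cmod_RtoC_pos; last lra.
have E1 : Rpower U (- (1 + sigma / 2)) = U ^ k * Rpower U (- p).
  rewrite -(Rpower_pow k) // -Rpower_plus; congr Rpower; rewrite /p; ring.
have -> : Rpower w (- p) * Rpower U (- (1 + sigma / 2)) * Rpower V (- p)
  = U ^ k * Rpower (w * (U * V)) (- p).
  rewrite E1 -(Rpower_mult_distr w) // -(Rpower_mult_distr U) //; ring.
apply: Rmult_le_compat_l; first lra.
rewrite Rpower_Ropp; apply: Rinv_le_contravar; first exact: Rpower_pos.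
apply: (Rle_trans _ (Rpower (w * (U * V) + 1) p)).
  apply: Rle_Rpower_l; lra.
apply: Rle_Rpower; rewrite /p; lra.
Qed.

(** The factor (X N)^(k+1) accounts for the size of the divisor sums. With Z = X N e^(-u), Z^(k+1)
    e^(-Z) is O(Z^(-2)); this buys N^(-2) at the price of e^((k+3) u), which e^(- e^u) absorbs at
    +oo. *)
Lemma bessel_integrand_bound (k : nat) (sigma X : R) : 0 < sigma -> 0 < X ->
  exists K, 0 <= K /\ forall u N, 0 < N ->
  (X * N) ^ (k + 1) * (exp (sigma * u) * exp (- (exp u + X * N * exp (- u))))
  <= K * / (1 + u ^ 2) * Rpower N (Ropp 2).
Proof.
move=> Hs HX; have Hk := pos_INR k.
have [Kg [HKg Hg]] := gamma_decay (sigma + INR k + 3) ltac:(lra).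
have [K [HK H]] := pow_exp_neg_le (k + 1) 2 1 ltac:(lra) ltac:(lra).
exists (K * Rpower X (Ropp 2) * Kg); split.
  apply: Rmult_le_pos; last lra; apply: Rmult_le_pos; [lra | exact: Rlt_le (Rpower_pos _ _)].
move=> u N HN.
have HXN : 0 < X * N by exact: Rmult_lt_0_compat.
have Hx : 0 < X * N * exp (- u) by apply: Rmult_lt_0_compat => //; exact: exp_pos.
have H1 := H _ Hx; rewrite Rmult_1_l in H1.
rewrite -(Rpower_mult_distr (X * N)) // -?(Rpower_mult_distr X) // in H1; last exact: exp_pos.
rewrite Rpower_exp Rpow_mult_distr in H1.
have -> : - (exp u + X * N * exp (- u)) = - exp u + - (X * N * exp (- u)) by ring.
rewrite exp_plus.
have E : exp (- u) ^ (k + 1) = exp (- ((INR k + 1) * u)).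
  rewrite -(Rpower_pow (k + 1)); last exact: exp_pos.
  rewrite Rpower_exp plus_INR INR_1; congr exp; ring.
rewrite E in H1.
set Z := exp (- (X * N * exp (- u))) in H1 *.
set B := exp (sigma * u) * exp (- exp u) * exp ((INR k + 1) * u).
have HB : 0 < B by apply: Rmult_lt_0_compat; last exact: exp_pos; apply: Rmult_lt_0_compat; exact: exp_pos.
have HE : exp (- ((INR k + 1) * u)) * exp ((INR k + 1) * u) = 1 by rewrite -exp_plus Rplus_opp_l exp_0.
have -> : (X * N) ^ (k + 1) * (exp (sigma * u) * (exp (- exp u) * Z))
  = B * ((X * N) ^ (k + 1) * exp (- ((INR k + 1) * u)) * Z).
  rewrite /B.
  have -> : exp (sigma * u) * exp (- exp u) * exp ((INR k + 1) * u) * ((X * N) ^ (k + 1) * exp (- ((INR k + 1) * u)) * Z)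
   = (exp (- ((INR k + 1) * u)) * exp ((INR k + 1) * u)) * ((X * N) ^ (k + 1) * (exp (sigma * u) * (exp (- exp u) * Z))) by ring.
  rewrite HE; ring.
apply: (Rle_trans _ _ _ (Rmult_le_compat_l _ _ _ (Rlt_le _ _ HB) H1)).
have E2 : exp ((sigma + INR k + 3) * u - exp u) = B * exp (- (2) * - u).
  rewrite /B -!exp_plus; congr exp; ring.
have Hgu := Hg u; rewrite E2 in Hgu.
set W := K * Rpower X (Ropp 2) * Rpower N (Ropp 2).
have HW : 0 <= W.
  rewrite /W; have HR x := Rlt_le _ _ (Rpower_pos x (Ropp 2)).
  by apply: Rmult_le_pos => //; apply: Rmult_le_pos => //; lra.
have -> : K * Rpower X (Ropp 2) * Kg * / (1 + u ^ 2) * Rpower N (Ropp 2) = W * (Kg * / (1 + u ^ 2)) by rewrite /W; ring.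
have -> : B * (K * (Rpower X (Ropp 2) * Rpower N (Ropp 2) * exp (- (2) * - u))) = W * (B * exp (- (2) * - u)) by rewrite /W; ring.
exact: Rmult_le_compat_l.
Qed.

Lemma is_series_RtoC (u : nat -> R) (l : R) :
  is_series u l -> is_series (V := C_NormedModule) (fun n => RtoC (u n)) (RtoC l).
Proof.
move=> H; apply: (clim_ext (fun N => RtoC (sum_n u N))).
  elim=> [|N IH]; first by rewrite !sum_O.
  by rewrite Csum_S sum_Sn -IH -RtoC_plus.
exact: clim_RtoC H.
Qed.

Lemma is_series_Cscal (c : C) (u : nat -> C) (l : C) :
  is_series (V := C_NormedModule) u l -> is_series (V := C_NormedModule) (fun n => c * u n)%C (c * l)%C.
Proof. exact: (is_series_scal_l (K := C_AbsRing) (V := C_NormedModule) c). Qed.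

Lemma cpowR_mult (b c : R) (s : C) : 0 < b -> 0 < c -> cpowR (b * c) s = (cpowR b s * cpowR c s)%C.
Proof.
move=> Hb Hc; rewrite /cpowR -cexp_plus ln_mult // RtoC_plus; congr cexp; ring.
Qed.

Lemma cpowR_plus (b : R) (s t : C) : cpowR b (s + t)%C = (cpowR b s * cpowR b t)%C.
Proof. rewrite /cpowR -cexp_plus; congr cexp; ring. Qed.

Lemma cpowR_nat (b : R) (n : nat) : 0 < b -> cpowR b (RtoC (INR n)) = RtoC (b ^ n).
Proof.
move=> Hb; rewrite -(Rpower_pow n) // /cpowR /Rpower -RtoC_mult /cexp /RtoC /Re /Im /= cos_0 sin_0.
congr pair; ring.
Qed.

Lemma cexp_RtoC (t : R) : cexp (RtoC t) = RtoC (exp t).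
Proof. rewrite /cexp /RtoC /Re /Im /= cos_0 sin_0; congr pair; ring. Qed.

Definition dual_integrand (k : nat) (s : C) (w u U V : R) : C :=
  (RtoC (U ^ k) * (cexp (s * RtoC u) * RtoC (exp (- ((w * (U * V) + 1) * exp u)))))%C.

Definition dual_value (k : nat) (s : C) (w U V : R) : C :=
  (RtoC (U ^ k) / cpowR (w * (U * V) + 1) s)%C.

(** The summand 1 in w U V + 1 splits off the weight e^(- e^u); what is left is the dual series with
    parameter w e^u = 4 pi^2 / y at y = X e^(-u). *)
Lemma dual_integrand_quad (k : nat) (s : C) (w u theta psi : R) (m n : nat) :
  quad (dual_integrand k s w u) theta psi m n
  = (cexp (s * RtoC u) * RtoC (exp (- exp u)) * RtoC (dual_quad k theta psi (w * exp u) m n))%C.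
Proof.
have E U V : dual_integrand k s w u U V = (cexp (s * RtoC u) * RtoC (exp (- exp u)) * RtoC (dual_term k (w * exp u) U V))%C.
  rewrite /dual_integrand /dual_term.
  have -> : - ((w * (U * V) + 1) * exp u) = - exp u + - (w * exp u * (U * V)) by ring.
  rewrite exp_plus !RtoC_mult; ring.
rewrite /quad !E /dual_quad RtoC_plus !RtoC_minus; ring.
Qed.

Lemma is_int_dual_quad (k : nat) (s : C) (w theta psi : R) : 0 < Re s -> 0 < w ->
  0 < theta < 1 -> 0 < psi < 1 -> forall m n,
  is_int (fun u => quad (dual_integrand k s w u) theta psi m n)
    (CGamma s * quad (dual_value k s w) theta psi m n)%C.
Proof.
move=> Hs Hw Ht Hp m n.
have -> : (CGamma s * quad (dual_value k s w) theta psi m n)%C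
  = quad (fun U V => CGamma s * dual_value k s w U V)%C theta psi m n by rewrite /quad; ring.
apply: is_int_quad => // U V HU HV.
have HB : 0 < w * (U * V) + 1.
  have : 0 < w * (U * V) by apply: Rmult_lt_0_compat => //; exact: Rmult_lt_0_compat.
  lra.
have H := is_int_scal (RtoC (U ^ k)) _ _ (is_int_gamma s _ Hs HB).
have -> : (CGamma s * dual_value k s w U V = RtoC (U ^ k) * (CGamma s / cpowR (w * (U * V) + 1) s))%C.
  rewrite /dual_value /Cdiv; ring.
exact: H.
Qed.

Lemma double_series_dominated (t : nat -> nat -> C) (A B : nat -> R) :
  ex_series A -> ex_series B -> (forall m, 0 <= A m) ->
  (forall m n, Cmod (t m n) <= A m * B n) -> exists L, is_dsum t L.
Proof.
move=> HA HB A0 Ht.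
have HBm m : ex_series (fun n => A m * B n) by apply: (ex_series_scal_l (K := R_AbsRing)).
have Habs m : ex_series (fun n => Cmod (t m n)).
  apply: (ex_series_le_pos _ (fun n => A m * B n)) => // n; split; [exact: Cmod_ge_0 | exact: Ht].
have Hle m : Series (fun n => Cmod (t m n)) <= A m * Series B.
  rewrite -Series_scal_l; apply: Series_le => // n; split; [exact: Cmod_ge_0 | exact: Ht].
have HG m : exists g : C, is_series (V := C_NormedModule) (t m) g.
  exact: (ex_series_le (V := C_CompleteNormedModule) (t m) (fun n => A m * B n) (Ht m) (HBm m)).
have [G HGm] := functional_choice _ HG.
have [L HL] : exists L : C, is_series (V := C_NormedModule) G L.
  apply: (ex_series_le (V := C_CompleteNormedModule) G (fun m => A m * Series B)).
    move=> m; rewrite -Series_scal_l.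
    exact: (norm_series_le (V := C_CompleteNormedModule) (t m) (fun n => A m * B n) (G m) (Ht m) (HBm m) (HGm m)).
  exact: ex_series_scal_r.
exists L; split; [exact: Habs | split; last by exists G].
apply: (ex_series_le_pos _ (fun m => A m * Series B)).
  move=> m; split; last exact: Hle.
  rewrite -(Rmult_0_l (Series (fun n => Cmod (t m n)))) -Series_scal_l.
  apply: Series_le => // n; rewrite Rmult_0_l; split; [exact: Rle_refl | exact: Cmod_ge_0].
exact: ex_series_scal_r.
Qed.

Theorem theorem2p15 (a x theta psi : R) (k : nat) (nu : C)
  (ha : 0 < a) (hx : 0 < x) (htheta : 0 < theta < 1) (hpsi : 0 < psi < 1)
  (hk : (2 <= k)%nat) (hkeven : Nat.Even k) (hnu : 0 < Re nu) :
  let s : C := Cplus nu (RtoC (INR k + 1)) in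
  let c : R := 16 * PI ^ 2 / a ^ 2 in
  let f (u v : R) : C :=
    Cdiv (RtoC (u ^ k)) (cpowR (c * (u * v) / x + 1) s) in
  exists Sv L : C,
    is_series
      (fun n : nat =>
         let N := INR (S n) in
         Cmult (Cmult (cpowR N (Cdiv nu (RtoC 2)))
                      (BesselK nu (a * sqrt (N * x))))
               (RtoC (divisor_sum
                        (fun d => INR d ^ k * cos (2 * PI * INR d * theta)
                                  * sin (2 * PI * N * psi / INR d))
                        (S n))))
      Sv /\
    is_dsum
      (fun m n : nat =>
         let M := INR m in let N := INR n in
         Cplus (Cminus (Cminus (f (N + psi) (M + theta))
                               (f (N + 1 - psi) (M + theta)))
                       (f (N + 1 - psi) (M + 1 - theta)))
               (f (N + psi) (M + 1 - theta)))
      L /\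
    Cmult (cpowR (a ^ 2 * x / 4) (Cplus (Cdiv nu (RtoC 2)) (RtoC (INR k + 1)))) Sv
    = Cmult (Cmult (RtoC ((-1) ^ (k / 2) * (2 * PI) ^ (k + 1) / 8)) (CGamma s)) L.
Proof.
move=> s c f.
have HPI := PI_RGT_0.
have [h Hkh] := hkeven.
have -> : (k / 2 = h)%nat by rewrite Hkh Nat.mul_comm Nat.div_mul.
have Hk0 := pos_INR k.
set sigma := Re nu in hnu.
have Hres : Re s = sigma + INR k + 1 by rewrite /s re_plus /sigma /=; ring.
set X := a ^ 2 * x / 4.
have HX : 0 < X.
  apply: Rdiv_lt_0_compat; last lra; apply: Rmult_lt_0_compat => //; exact: pow_lt.
(* Equal to 16 pi^2 / (a^2 x), the coefficient of U V in the theorem. *)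
set w := 4 * PI ^ 2 / X.
have Hw : 0 < w by apply: Rdiv_lt_0_compat => //; apply: Rmult_lt_0_compat; [lra | exact: pow_lt].
have Hf U V : f U V = dual_value k s w U V.
  rewrite /f /dual_value; congr (_ / cpowR _ _)%C; rewrite /c /w /X; field; split; lra.
set p := INR k + 1 + sigma / 2; set q := 1 + sigma / 2.
set gam := shift_weight theta p; set alp := shift_weight psi q.
have Hgam : ex_series gam by apply: ex_series_shift_weight => //; rewrite /p; lra.
have Halp : ex_series alp by apply: ex_series_shift_weight => //; rewrite /q; lra.
have gam0 m : 0 <= gam m by exact: Rlt_le (shift_weight_pos _ _ _).
have alp0 m : 0 <= alp m by exact: Rlt_le (shift_weight_pos _ _ _).
set cst := (-1) ^ h * (2 * PI) ^ (k + 1) / 8.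
have [K3 [HK3 Hval]] := dual_value_bound k w s sigma hnu Hw Hres.
have Hval' := Cmod_quad_le (dual_value k s w) K3 p q theta psi Hval htheta hpsi.
have [L HL] := double_series_dominated (quad (dual_value k s w) theta psi) (fun m => K3 * gam m) alp
  ltac:(by apply: (ex_series_scal_l (K := R_AbsRing))) Halp
  (fun m => Rmult_le_pos _ _ HK3 (gam0 m)) Hval'.
have [_ [_ [G [HG HGL]]]] := HL.
(* the integrand, through the transformation formula at y = X exp (- u) *)
have Htr u := lambert_transform k h (X * exp (- u)) theta psi hk Hkh
  (Rmult_lt_0_compat _ _ HX (exp_pos _)) htheta hpsi.
have [Hfun Htr1] := functional_choice _ Htr.
have [T Htr2] := functional_choice _ Htr1 => {Htr Htr1}.
pose E u := (cexp (s * RtoC u) * RtoC (exp (- exp u)))%C.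
have Hwu u : 4 * PI ^ 2 / (X * exp (- u)) = w * exp u.
  rewrite exp_Ropp /w; field; split; [lra | exact: Rgt_not_eq (exp_pos _)].
have [K1 [HK1 Hint]] := dual_integrand_bound k sigma w hnu Hw.
have Hint' u m n : Cmod (quad (dual_integrand k s w u) theta psi m n) <= K1 * / (1 + u ^ 2) * gam m * alp n.
  apply: Cmod_quad_le => // U V HU HV.
  rewrite /dual_integrand Cmod_mult Cmod_cexp_mult; last exact: Rlt_le (exp_pos _).
  rewrite Cmod_RtoC_pos; last by apply: pow_le; lra.
  rewrite Hres; exact: Hint.
have Hrow u m : is_series (V := C_NormedModule) (fun n => quad (dual_integrand k s w u) theta psi m n)
    (E u * RtoC (Hfun u m))%C.
  have [_ [H _]] := Htr2 u.
  apply: is_series_ext (is_series_Cscal (E u) _ _ (is_series_RtoC _ _ (H m))) => n.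
  by rewrite dual_integrand_quad Hwu.
(* Termwise integration is carried out over n for fixed m and afterwards over m, following the
   iterated sum in [is_dsum]. *)
have Hrow_int m : exists j, is_int (fun u => E u * RtoC (Hfun u m))%C j /\
    is_series (V := C_NormedModule) (fun n => CGamma s * quad (dual_value k s w) theta psi m n)%C j.
  apply: (is_int_series (fun n u => quad (dual_integrand k s w u) theta psi m n) _ _ (fun n => K1 * gam m * alp n)).
  - move=> n; apply: is_int_dual_quad => //; rewrite Hres; lra.
  - by apply: (ex_series_scal_l (K := R_AbsRing)).
  - move=> n; apply: Rmult_le_pos => //; exact: Rmult_le_pos.
  - move=> n u; apply: Rle_trans (Hint' u m n) _; apply: Req_le; ring.
  - move=> u; exact: Hrow.
have [J HJ] := functional_choice _ Hrow_int.
have [Jtot [HJint HJser]] : exists j, is_int (fun u => E u * RtoC (T u))%C j /\ is_series (V := C_NormedModule) J j.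
  apply: (is_int_series (fun m u => E u * RtoC (Hfun u m))%C _ _ (fun m => K1 * gam m * Series alp)).
  - move=> m; exact: (proj1 (HJ m)).
  - apply: ex_series_scal_r; by apply: (ex_series_scal_l (K := R_AbsRing)).
  - move=> m; apply: Rmult_le_pos; first exact: Rmult_le_pos.
    rewrite -(Rmult_0_l (Series alp)) -Series_scal_l; apply: Series_le => // n.
    by rewrite Rmult_0_l; split; [exact: Rle_refl | exact: alp0].
  - move=> m u.
    have H := norm_series_le (V := C_CompleteNormedModule) _ _ _ (Hint' u m)
      ltac:(by apply: (ex_series_scal_l (K := R_AbsRing))) (Hrow u m).
    rewrite Series_scal_l in H; apply: Rle_trans H _; apply: Req_le; ring.
  - move=> u; have [_ [_ H]] := Htr2 u.
    exact: is_series_Cscal (is_series_RtoC _ _ H).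
have HJtot : Jtot = (CGamma s * L)%C.
  apply: (is_series_unique_V (V := C_NormedModule) J) => //.
  apply: is_series_ext (is_series_Cscal (CGamma s) _ _ HGL) => m.
  exact: (is_series_unique_V (V := C_NormedModule) _ _ _ (is_series_Cscal (CGamma s) _ _ (HG m)) (proj2 (HJ m))).
pose coef N := lambert_coef k theta psi (S N).
(* The factor X^(k+1) / 2 makes both sides match: 1/2 cancels the 2 of the Bessel integral and turns
   the 1/4 of the transformation into 1/8, while X^(k+1) cancels the power of y = X e^(-u) up to
   e^((k+1) u). *)
pose g N u := (RtoC (X ^ (k + 1) / 2 * coef N) *
  (cexp (nu * RtoC u) * RtoC (exp (- (exp u + X * INR (S N) * exp (- u))))))%C.
pose I N := (RtoC (X ^ (k + 1) / 2 * coef N) *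
  (RtoC 2 * cpowR (X * INR (S N)) (nu / RtoC 2) * BesselK nu (2 * sqrt (X * INR (S N)))))%C.
have HN N : 0 < INR (S N) by apply: lt_0_INR; lia.
have HXN N : 0 < X * INR (S N) by exact: Rmult_lt_0_compat.
have [K2 [HK2 Hbes]] := bessel_integrand_bound k sigma X hnu HX.
have [Jb [HJbint HJbser]] : exists j, is_int (fun u => RtoC cst * (E u * RtoC (T u)))%C j /\ is_series (V := C_NormedModule) I j.
  apply: (is_int_series g _ _ (fun N => K2 * Rpower (INR N + 1) (Ropp 2))).
  - move=> N; apply: is_int_scal; exact: is_int_bessel.
  - apply: (ex_series_scal_l (K := R_AbsRing)); apply: (ex_series_Rpower 2); lra.
  - move=> N; apply: Rmult_le_pos => //; exact: Rlt_le (Rpower_pos _ _).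
  - move=> N u; rewrite /g Cmod_mult Cmod_cexp_mult; last exact: Rlt_le (exp_pos _).
    rewrite Cmod_R Rabs_mult (Rabs_pos_eq (_ / 2)); last first.
      apply: Rlt_le; apply: Rdiv_lt_0_compat; [exact: pow_lt | lra].
    have Hc := lambert_coef_le k theta psi (S N) ltac:(lia).
    have HXk : 0 < X ^ (k + 1) by exact: pow_lt.
    rewrite -S_INR.
    have -> : K2 * Rpower (INR (S N)) (Ropp 2) * / (1 + u ^ 2) = K2 * / (1 + u ^ 2) * Rpower (INR (S N)) (Ropp 2) by ring.
    apply: Rle_trans (Hbes u (INR (S N)) (HN N)).
    apply: Rmult_le_compat_r.
      by apply: Rmult_le_pos; exact: Rlt_le (exp_pos _).
    rewrite Rpow_mult_distr.
    apply: Rmult_le_compat => //; [lra | exact: Rabs_pos | lra].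
  - move=> u; have [H _] := Htr2 u.
    have HZ := is_series_Cscal (RtoC (X ^ (k + 1) / 2) * (cexp (nu * RtoC u) * RtoC (exp (- exp u))))%C _ _ (is_series_RtoC _ _ H).
    have Hv : (RtoC cst * (E u * RtoC (T u)) = RtoC (X ^ (k + 1) / 2) * (cexp (nu * RtoC u) * RtoC (exp (- exp u))) *
       RtoC ((-1) ^ h * (2 * PI / (X * exp (- u))) ^ (k + 1) / 4 * T u))%C.
      (* The leftover e^((k+1) u) raises the exponent from nu on the Bessel side to s = nu + k + 1
         on the Gamma side. *)
      have E1 : cexp (s * RtoC u) = (cexp (nu * RtoC u) * RtoC (exp (u) ^ (k + 1)))%C.
        have -> : (s * RtoC u = nu * RtoC u + RtoC ((INR k + 1) * u))%C by rewrite /s RtoC_mult; ring.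
        rewrite cexp_plus cexp_RtoC; congr (_ * RtoC _)%C.
        by rewrite -(Rpower_pow (k + 1)) ?Rpower_exp ?plus_INR ?INR_1 //; exact: exp_pos.
      have E2 : X ^ (k + 1) / 2 * ((-1) ^ h * (2 * PI / (X * exp (- u))) ^ (k + 1) / 4 * T u) = cst * exp u ^ (k + 1) * T u.
        have -> : 2 * PI / (X * exp (- u)) = (2 * PI) * exp u * / X.
          rewrite exp_Ropp; field; split; [lra | exact: Rgt_not_eq (exp_pos _)].
        rewrite /cst (Rpow_mult_distr (2 * PI * exp u) (/ X)) (Rpow_mult_distr (2 * PI) (exp u)) pow_inv; field; apply: pow_nonzero; lra.
      have -> : (RtoC (X ^ (k + 1) / 2) * (cexp (nu * RtoC u) * RtoC (exp (- exp u))) *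
          RtoC ((-1) ^ h * (2 * PI / (X * exp (- u))) ^ (k + 1) / 4 * T u))%C
        = (cexp (nu * RtoC u) * RtoC (exp (- exp u)) * RtoC (X ^ (k + 1) / 2 * ((-1) ^ h * (2 * PI / (X * exp (- u))) ^ (k + 1) / 4 * T u)))%C.
        rewrite (RtoC_mult (X ^ (k + 1) / 2)); ring.
      rewrite E2 /E E1 !RtoC_mult; ring.
    rewrite Hv; apply: is_series_ext HZ => N; eqC.
    rewrite /g /coef.
    have -> : - (exp u + X * INR (S N) * exp (- u)) = - exp u + - (X * exp (- u) * INR (S N)) by ring.
    rewrite exp_plus !RtoC_mult; ring.
have HJb : Jb = (RtoC cst * (CGamma s * L))%C.
  rewrite -HJtot; exact: is_int_unique HJbint (is_int_scal _ _ _ HJint).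
(* The prefactor X^(nu/2+k+1) of the theorem: X^(nu/2) comes from (X N)^(nu/2), X^(k+1) from the
   factor in [g]. As it never vanishes, the sum of the Bessel series can be given as [Jb] divided by
   it. *)
set D := cpowR X _.
have HD : D <> 0 by exact: cexp_neq_0.
exists (/ D * Jb)%C, L; split; [|split].
- apply: is_series_ext (is_series_Cscal (/ D)%C _ _ HJbser) => N; eqC.
  have Hsq : 2 * sqrt (X * INR (S N)) = a * sqrt (INR (S N) * x).
    have -> : X * INR (S N) = (a / 2) * (a / 2) * (INR (S N) * x) by rewrite /X; field.
    rewrite sqrt_mult_alt; last by nra.
    rewrite sqrt_square; last lra.
    field.
  rewrite /I Hsq cpowR_mult // /coef /lambert_coef.
  have ED : D = (cpowR X (nu / RtoC 2) * RtoC (X ^ (k + 1)))%C.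
    rewrite /D cpowR_plus -(cpowR_nat X (k + 1)) // plus_INR INR_1 //.
  have HXk : RtoC (X ^ (k + 1)) <> 0.
    move=> /RtoC_inj; apply: pow_nonzero; lra.
  have HcX : cpowR X (nu / RtoC 2) <> 0 by exact: cexp_neq_0.
  have H2 : RtoC 2 <> 0 by move=> /RtoC_inj; lra.
  rewrite ED RtoC_mult RtoC_div; last lra.
  field; by repeat split.
- have -> : (fun m n : nat => let M := INR m in let N := INR n in
       Cplus (Cminus (Cminus (f (N + psi) (M + theta)) (f (N + 1 - psi) (M + theta)))
                       (f (N + 1 - psi) (M + 1 - theta))) (f (N + psi) (M + 1 - theta)))
    = quad (dual_value k s w) theta psi; last exact: HL.
  apply: FunctionalExtensionality.functional_extensionality => m.
  apply: FunctionalExtensionality.functional_extensionality => n.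
  by rewrite /= !Hf.
- rewrite HJb Cmult_assoc Cinv_r // Cmult_1_l -/cst; ring.
Qed.
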